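(* Let $p$ be a prime number and let $\lambda$ be an infinite cardinal. If $\lambda^{\aleph_0}=\lambda$ or $\forall \mu<\lambda\,(\mu^{\aleph_0}<\lambda)$ (where $\mu$ ranges over cardinals), then there is a universal abelian $p$-group for purity of cardinality $\lambda$. Moreover, for every integer $n\geq 2$, there is a universal abelian $p$-group for purity of cardinality $\aleph_n$ if and only if $2^{\aleph_0}\leq \aleph_n$.
   Context: An abelian $p$-group is an abelian group in which every nonzero element has order $p^n$ for some $n\in\mathbb{N}$. A subgroup $G$ of an abelian group $H$ is a pure subgroup, written $G\leq_p H$, if $nH\cap G=nG$ for every $n\in\mathbb{N}$. A pure embedding $f:G\to H$ is an injective homomorphism whose image is a pure subgroup of $H$. A universal abelian $p$-group for purity of cardinality $\lambda$ is an abelian $p$-group $U_\lambda$ of cardinality $\lambda$ such that every abelian $p$-group of cardinality $\leq\lambda$ purely embeds in $U_\lambda$. *)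

(* Defs.v *)
From mathcomp Require Export all_boot all_order all_algebra.
From mathcomp Require Export boolp classical_sets functions cardinality.

Set Implicit Arguments.
Unset Strict Implicit.
Unset Printing Implicit Defensive.

Import GRing.Theory.
Local Open Scope classical_set_scope.
Local Open Scope card_scope.
Local Open Scope ring_scope.

(* A cardinal is represented by any type having that cardinality.  Naming the
   sort keeps all cardinals in the same universe, so that "every cardinal below
   L" really ranges over all of them (every subset of L lives there). *)
Definition cardinal := Type.

Definition cardinal_le (M L : cardinal) : Prop := [set: M] #<= [set: L].

Definition cardinal_lt (M L : cardinal) : Prop :=
  cardinal_le M L /\ ~ cardinal_le L M.

Definition is_succ_cardinal (K L : cardinal) : Prop :=
  cardinal_lt K L /\ forall M : cardinal, cardinal_lt K M -> cardinal_le L M.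

(* [is_aleph n L] : L has cardinality aleph_n.  Such an L exists for every n and
   is unique up to equipotence. *)
Fixpoint is_aleph (n : nat) (L : cardinal) : Prop :=
  if n is n'.+1 then exists2 K : cardinal, is_aleph n' K & is_succ_cardinal K L
  else [set: L] #= [set: nat].

Definition has_order (G : zmodType) (x : G) (m : nat) : Prop :=
  [/\ (0 < m)%N, x *+ m = 0 &
      forall k : nat, (0 < k < m)%N -> x *+ k <> 0].

Definition abelian_pgroup (p : nat) (G : zmodType) : Prop :=
  forall x : G, x <> 0 -> exists n : nat, has_order x (p ^ n)%N.

Definition pure_subgroup (H : zmodType) (G : set H) : Prop :=
  zmod_closed [in G] /\
  forall n : nat, [set x *+ n | x in [set: H]] `&` G = [set x *+ n | x in G].

Definition pure_embedding (G H : zmodType) (f : {additive G -> H}) : Prop :=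
  injective f /\ pure_subgroup (range f).

Definition universal_pgroup (p : nat) (L : cardinal) (U : zmodType) : Prop :=
  [/\ abelian_pgroup p U,
      [set: U] #= [set: L] &
      forall G : zmodType, abelian_pgroup p G -> [set: G] #<= [set: L] ->
        exists f : {additive G -> U}, pure_embedding f].

(* Main.v *)
From HB Require Import structures.
From mathcomp Require Import ring_quotient wochoice zify.
Require Import Defs.

Local Open Scope classical_set_scope.
Local Open Scope card_scope.

Set Implicit Arguments.
Unset Strict Implicit.
Unset Printing Implicit Defensive.

Import GRing.Theory.

(** Existence.  Let [D] be the Pruefer group, with [zeta] of order [p].  The
    [p]-group to embed into is a torsion subgroup of a product of copies of the
    group [D^(L)] of finitely supported functions: coordinate [0] is all of
    [D^(L)], coordinate [k > 0] is its [p ^ k]-torsion, and an element has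
    bounded order ([ladder]).  In a [p]-group [G], an embedding is pure as soon
    as it preserves heights on the socle.  So choose, for each [k], a
    homomorphism to coordinate [k + 1] that kills [p ^ k.+1 G] and is nonzero
    at the elements of the socle of height exactly [k], and one to
    coordinate [0] that is injective on the elements of infinite height
    ([exists_ladder_map]).  These homomorphisms are built on a subgroup by
    sending new elements to new basis vectors, and extended to [G] by
    divisibility ([exists_separating_map]).  The ladder group over [L] has size
    [L ^ omega], which settles the case [L ^ omega = L].  If [mu ^ omega < L]
    for all [mu < L], then either [L ^ omega = L] again, or [L] is the union of
    an increasing sequence of parts [A n] with [A n ^ omega <= L]
    ([countable_exhaustion]).  In the latter case the direct sum of the ladder
    groups over the [A n] works: a [p]-group of size [L] is an increasing union
    of pure subgroups [G n] of size at most [A n], and the maps above, applied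
    to [G n] relative to the preceding subgroup, are the components of a pure
    embedding ([exists_universal_pgroup]).

    Alephs.  If [aleph_n] is at least the continuum, [aleph_n ^ omega = aleph_n]
    by Hausdorff's formula ([is_aleph_countable_power]).  Conversely, let [U] be
    universal of size [aleph_n] with [2 <= n], and well-order [U] in type
    [omega_n].  Shelah's club guessing gives [aleph_n] increasing
    [omega]-sequences in [U] such that every club contains one of them
    ([exists_guessing_sequences]).  Following Kojman and Shelah, an element [u]
    and a sequence [c] of the family determine the set of the [k] such that [u]
    is not congruent modulo [p ^ k.+1] to any element below [c (2k+1)].
    A group of size [aleph_n] can be built in which each guessing sequence has
    an element with a prescribed set ([exists_coding_group]); and a pure embedding
    in [U] preserves these sets along the sequences that lie in a
    suitable club.  Hence all subsets of the integers appear among the at most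
    [aleph_n] sets coming from [U] ([universal_pgroup_continuum]). *)

(** * Cardinal arithmetic *)

Definition embeds (A B : Type) : Prop := exists f : A -> B, injective f.

Lemma embeds_refl A : embeds A A.
Proof. by exists id. Qed.

Lemma sval_inj A (P : A -> Prop) : injective (@sval A P).
Proof. by move=> x y; apply: eq_sig_hprop. Qed.

Lemma embeds_trans B A C : embeds A B -> embeds B C -> embeds A C.
Proof. by move=> [f fI] [g gI]; exists (g \o f); apply: inj_comp. Qed.

Lemma cardinal_leE (A B : cardinal) : cardinal_le A B <-> embeds A B.
Proof.
split=> [/card_leP[f]|[f fI]].
  exists (fun a => val (f (SigSub (mem_setT a)))) => a b /val_inj.
  by move/(inj (mem_setT _) (mem_setT _)) => -[].
apply/card_leP.
have fI' : {in [set: A] &, injective f} by move=> a b _ _; apply: fI.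
have [F _] := Pinj fI'.
exact/card_leP/(inj_card_le ('totalfun_[set: A] F)).
Qed.

Lemma cardinal_eqE (A B : cardinal) :
  ([set: A] #= [set: B]) = true <-> embeds A B /\ embeds B A.
Proof.
rewrite -!cardinal_leE /cardinal_le; split=> [|[h1 h2]].
  by rewrite card_eq_le => /andP[].
by rewrite card_eq_le h1 h2.
Qed.

Lemma embeds_prod A B C D : embeds A C -> embeds B D -> embeds (A * B) (C * D).
Proof.
move=> [f fI] [g gI]; exists (fun x => (f x.1, g x.2)).
by move=> [a b] [c d] /= [/fI -> /gI ->].
Qed.

Lemma embeds_fun I A B : embeds A B -> embeds (I -> A) (I -> B).
Proof.
move=> [f fI]; exists (fun u => f \o u) => u v uv; apply: funext => i.
by apply: fI; rewrite -[f _]/((f \o u) i) uv.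
Qed.

Lemma infinite_embeds_nat (L : Type) :
  infinite_set [set: L] <-> embeds nat L.
Proof. by rewrite infiniteP -cardinal_leE. Qed.

(** Starting from [B0] spares the empty chain, whose union need not satisfy
    [P]. *)
Lemma Zorn_above (T : Type) (P : set (set T)) (B0 : set T) : P B0 ->
  (forall F : set (set T), F `<=` P -> F !=set0 -> total_on F subset ->
     P (\bigcup_(X in F) X)) ->
  exists A, [/\ P A, B0 `<=` A & forall B, A `<=` B -> P B -> B `<=` A].
Proof.
move=> PB0 PU; pose Q X := P (X `|` B0).
have [F FQ Ftot|A [QA Amax]] := @Zorn_bigcup T Q; last first.
  exists (A `|` B0); split=> // B AB PB x Bx; left.
  have [Ax|nAx] := pselect (A x); first by [].
  have sAB : A `<` B.
    by split; [move=> y Ay; apply: AB; left|move=> BA; apply/nAx/BA].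
  exfalso; apply: (Amax B sAB); rewrite /Q (_ : B `|` B0 = B) //.
  by apply/seteqP; split=> y; [case=> // By0; apply: AB; right|left].
have [->|/set0P[X0 FX0]] := eqVneq F set0; first by rewrite /Q bigcup_set0 set0U.
rewrite /Q; have -> : (\bigcup_(X in F) X) `|` B0 =
    \bigcup_(Y in [set X `|` B0 | X in F]) Y.
  apply/seteqP; split=> x.
    case=> [[X FX Xx]|B0x]; first by exists (X `|` B0); [exists X|left].
    by exists (X0 `|` B0); [exists X0|right].
  by case=> Y [X FX <-] [Xx|B0x]; [left; exists X|right].
apply: PU; first by move=> _ [X FX <-]; apply: FQ.
  by exists (X0 `|` B0), X0.
move=> _ _ [X FX <-] [Y FY <-].
by have [XY|YX] := Ftot _ _ FX FY; [left|right]; apply: setSU.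
Qed.

(** Any two types are comparable: a maximal partial injection exhausts one
    side. *)
Lemma embeds_total A B : embeds A B \/ embeds B A.
Proof.
pose P (G : set (A * B)) := forall x y, G x -> G y -> (x.1 = y.1 <-> x.2 = y.2).
have [|F FP _ Ftot|G [PG _ Gmax]] := @Zorn_above _ P set0.
- by move=> x y [].
- move=> x y [X FX Xx] [Y FY Yy].
  have [XY|YX] := Ftot _ _ FX FY.
    by apply: (FP _ FY) => //; apply: XY.
  by apply: (FP _ FX) => //; apply: YX.
have [domG|ndom] := pselect (forall a, exists b, G (a, b)).
  have [f fG] := choice domG; left; exists f => a a' faa.
  by apply/(PG _ _ (fG a) (fG a')).
have [ranG|nran] := pselect (forall b, exists a, G (a, b)).
  have [f fG] := choice ranG; right; exists f => a a' faa.
  by apply/(PG _ _ (fG a) (fG a')).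
move/existsNP : ndom => [a /forallNP na]; move/existsNP : nran => [b /forallNP nb].
exfalso; apply: (na b).
apply: (Gmax (G `|` [set (a, b)])); [by left| |by right].
move=> [x x'] [y y'] /= [Gx|[-> ->]] [Gy|[-> ->]] //.
- exact: (PG _ _ Gx Gy).
- by split=> e; [case: (na x')|case: (nb x)]; rewrite -e.
- by split=> e; [case: (na y')|case: (nb y)]; rewrite e.
Qed.

Lemma prod_nat : embeds (nat * nat) nat.
Proof. by exists pickle; apply: pcan_inj pickleK. Qed.

Section Square.
Variables (A : Type) (iota : nat -> A).
Hypothesis iotaI : injective iota.

(** Ternary relations that are graphs of injections [D * D -> D], the set [D]
    being read off from the diagonal. *)
Let D (G : set (A * A * A)) : set A := [set x | exists z, G (x, x, z)].
Let pairing (G : set (A * A * A)) :=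
  [/\ forall x y z, G (x, y, z) -> [/\ D G x, D G y & D G z],
      forall x y, D G x -> D G y -> exists z, G (x, y, z) &
      forall u v z z', G (u, z) -> G (v, z') -> (u = v <-> z = z')].

Let pairing_nat (f : nat * nat -> nat) : injective f ->
  pairing [set t | exists i j, t = (iota i, iota j, iota (f (i, j)))].
Proof.
move=> fI; set G := [set t | _].
have DG i : D G (iota i) by exists (iota (f (i, i))), i, i.
split.
- by move=> x y z [i [j [-> -> ->]]].
- move=> x y [_ [i [_ [-> _ _]]]] [_ [j [_ [-> _ _]]]].
  by exists (iota (f (i, j))), i, j.
- move=> u v z z' [i [j [-> ->]]] [i' [j' [-> ->]]]; split.
    by move=> [/iotaI -> /iotaI ->].
  by move=> /iotaI/fI[-> ->].
Qed.

Let pairing_bigcup (F : set (set (A * A * A))) :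
  F `<=` pairing -> total_on F subset -> pairing (\bigcup_(X in F) X).
Proof.
move=> FP Ftot.
have DS X : F X -> D X `<=` D (\bigcup_(X in F) X).
  by move=> FX x [z Xz]; exists z, X.
have join X Y : F X -> F Y -> exists Z, [/\ F Z, X `<=` Z & Y `<=` Z].
  by move=> FX FY; have [XY|YX] := Ftot _ _ FX FY; [exists Y|exists X]; split.
split.
- move=> x y z [X FX /(let: And3 h _ _ := FP X FX in h x y z)[Dx Dy Dz]].
  by split; apply: (DS X).
- move=> x y [z [X FX Xz]] [z' [Y FY Yz']].
  have [Z [FZ XZ YZ]] := join _ _ FX FY.
  have [_ tot _] := FP _ FZ.
  have [||t Zt] := tot x y; [by exists z; apply: XZ|by exists z'; apply: YZ|].
  by exists t, Z.
- move=> u v z z' [X FX Xz] [Y FY Yz'].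
  have [Z [FZ XZ YZ]] := join _ _ FX FY.
  by have [_ _] := FP _ FZ; apply; [apply: XZ|apply: YZ].
Qed.

(** On a maximal pairing, the complement of [D] embeds in [D]: otherwise a
    disjoint copy [e D] of [D] sits outside, and the three new blocks of
    [(D + e D) * (D + e D)] fit into [e D]. *)
Lemma embeds_square : embeds (A * A) A.
Proof.
have [f fI] := prod_nat.
have [F FP _ Ftot|G [PG G0 Gmax]] := Zorn_above (pairing_nat fI).
  exact: pairing_bigcup.
have Diota i : D G (iota i) by exists (iota (f (i, i))); apply: G0; exists i, i.
have [Gd Gt Gi] := PG.
have mE : forall u : {x | D G x} * {x | D G x},
    exists z : {x | D G x}, G (sval u.1, sval u.2, sval z).
  move=> [[x Dx] [y Dy]]; have [z Gz] := Gt x y Dx Dy.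
  by have [_ _ Dz] := Gd _ _ _ Gz; exists (exist _ z Dz).
have [m mG] := choice mE.
have mI : injective m.
  move=> [x y] [x' y'] e; have := mG (x, y); rewrite e => /Gi /(_ (mG (x', y'))).
  by case=> _ /(_ erefl)[/eq_sig_hprop -> // /eq_sig_hprop ->].
pose d i : {x | D G x} := exist _ _ (Diota i).
have dI : injective d by move=> i j [/iotaI].
have [[e eI]|[e eI]] := embeds_total {x | ~ D G x} {x | D G x}.
  have gE : forall a, exists b : {x | D G x},
      match pselect (D G a) with
      | left Da => b = m (exist _ a Da, d 0%N)
      | right nDa => b = m (e (exist _ a nDa), d 1%N)
      end.
    by move=> a; case: pselect => Da; eexists.
  have [g gP] := choice gE.
  have gI : injective g.
    move=> a b; have := gP a; have := gP b.
    case: pselect => Db ->; case: pselect => Da -> /mI ab.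
    - by have := congr1 (fun u : {x | D G x} * {x | D G x} => sval u.1) ab.
    - by have /iotaI := congr1 (fun u : {x | D G x} * {x | D G x} => sval u.2) ab.
    - by have /iotaI := congr1 (fun u : {x | D G x} * {x | D G x} => sval u.2) ab.
    - by have := congr1 sval (eI _ _ (congr1 fst ab)).
  apply: (@embeds_trans ({x | D G x} * {x | D G x})).
    by apply: embeds_prod; exists g.
  apply: (@embeds_trans {x | D G x}); first by exists m.
  by exists sval => x y /eq_sig_hprop ->.
exfalso.
have [s [sI s0 s1]] : exists s : bool -> {x | D G x} -> A,
    [/\ forall i j x y, s i x = s j y -> i = j /\ x = y,
        forall x, s false x = sval x & forall x, ~ D G (s true x)].
  exists (fun i x => if i then sval (e x) else sval x); split=> // [[] [] x y|x].
  - by move=> /eq_sig_hprop h; split=> //; apply: eI; exact: h.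
  - by move=> exy; case: (svalP (e x)); rewrite exy; apply: svalP.
  - by move=> exy; case: (svalP (e y)); rewrite -exy; apply: svalP.
  - by move=> /eq_sig_hprop h; split=> //; apply: h.
  - exact: (svalP (e x)).
pose N : set (A * A * A) := [set t | exists x y, exists i j : bool,
  (i || j) /\ t = (s i x, s j y, s true (m (m (x, y), d (i + j.*2))))].
have GN x y z : G (x, y, z) -> exists x' y' z', [/\ x = s false x',
    y = s false y' & z = s false z'].
  move=> /Gd[Dx Dy Dz].
  by exists (exist _ x Dx), (exist _ y Dy), (exist _ z Dz); rewrite !s0.
have Ds i x : D (G `|` N) (s i x).
  case: i; last by have [z xz] := svalP x; exists z; left; rewrite s0.
  by eexists; right; exists x, x, true, true; split.
suff /(Gmax (G `|` N) (@subsetUl _ _ _)) NG : pairing (G `|` N).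
  have /NG/Gd[De _ _] : (G `|` N) (s true (d 0%N), s true (d 0%N),
      s true (m (m (d 0%N, d 0%N), d 3%N))).
    by right; exists (d 0%N), (d 0%N), true, true.
  exact: s1 De.
split.
  + move=> x y z [/GN[x' [y' [z' [-> -> ->]]]]|]; first by split; apply: Ds.
    by move=> [x' [y' [i [j [_ [-> -> ->]]]]]]; split; apply: Ds.
  + have DN x : D (G `|` N) x -> exists i x', x = s i x'.
      move=> [z [/GN[x' [_ [_ [-> _ _]]]]|]]; first by exists false, x'.
      by move=> [x' [_ [i [_ [_ [-> _ _]]]]]]; exists i, x'.
    move=> _ _ /DN[i [x ->]] /DN[j [y ->]].
    have [/orP ij|] := boolP (i || j).
      by eexists; right; exists x, y, i, j; split=> //; apply/orP.
    case: i; case: j => // _; have [z Gz] := Gt _ _ (svalP x) (svalP y).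
    by exists z; left; rewrite !s0.
  + move=> [x y] [x' y'] z z' [Gz|Nz] [Gz'|Nz'].
    * exact: Gi.
    * have [a [b [c [-> -> ->]]]] := GN _ _ _ Gz.
      have [a' [b' [i [j [ij [-> -> ->]]]]]] := Nz'.
      by split; [case=> /sI[iF _] /sI[jF _]; move: ij; rewrite -iF -jF|move=> /sI[]].
    * have [a [b [c [-> -> ->]]]] := GN _ _ _ Gz'.
      have [a' [b' [i [j [ij [-> -> ->]]]]]] := Nz.
      by split; [case=> /sI[iF _] /sI[jF _]; move: ij; rewrite iF jF|move=> /sI[]].
    * have [a [b [i [j [ij [-> -> ->]]]]]] := Nz.
      have [a' [b' [i' [j' [ij' [-> -> ->]]]]]] := Nz'.
      split; first by case=> /sI[-> ->] /sI[-> ->].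
      move=> /sI[_ /mI mm]; have [-> ->] := mI _ _ (congr1 fst mm).
      have := dI _ _ (congr1 snd mm).
      by case: i j i' j' ij ij' {Nz Nz' mm} => [] [] [] [].
Qed.

End Square.

Lemma embeds_seq A : embeds nat A -> embeds (seq A) A.
Proof.
move=> [iota iotaI]; have [f fI] := embeds_square iotaI.
pose enc := foldr (fun x c => f (x, c)) (iota 0%N).
exists (fun s => f (iota (size s), enc s)) => s t /fI[/iotaI].
elim: s t => [|x s IHs] [|y t] //= [st] /fI[-> /IHs <- //].
Qed.

Lemma embeds_sum A B C : embeds nat C -> embeds A C -> embeds B C ->
  embeds (A + B) C.
Proof.
move=> [iota iotaI] [f fI] [g gI]; have [h hI] := embeds_square iotaI.
exists (fun x => match x with inl a => h (f a, iota 0%N)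
                            | inr b => h (g b, iota 1%N) end).
by move=> [a|b] [a'|b'] /hI[] // => [/fI->|_ /iotaI|_ /iotaI|/gI->].
Qed.

Lemma embeds_Sigma I (T : I -> Type) B C : embeds nat C -> embeds I C ->
  embeds B C -> (forall i, embeds (T i) B) -> embeds {i : I & T i} C.
Proof.
move=> [iota iotaI] [f fI] [g gI] TB; have [h hI] := embeds_square iotaI.
pose e i := projT1 (cid (TB i)); have eI i : injective (e i) := projT2 (cid (TB i)).
exists (fun x => h (f (projT1 x), g (e _ (projT2 x)))).
move=> [i x] [j y] /hI[/= /fI ij]; move: ij y => <- y.
by move=> /gI/eI ->.
Qed.

Lemma embeds_unit : embeds unit nat.
Proof. by exists (fun=> 0%N) => -[] []. Qed.

Lemma embeds_sub A (P : A -> Prop) : embeds {x | P x} A.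
Proof. by exists sval => x y /eq_sig_hprop; apply. Qed.

Lemma embeds_quotient A B (f : A -> B) : (forall b, exists a, f a = b) -> embeds B A.
Proof. by move=> /choice[g gK]; exists g; apply: can_inj gK. Qed.

Lemma Cantor A : ~ embeds (A -> bool) A.
Proof.
move=> [f fI].
pose d a := `[< exists g, f g = a /\ g a = false >].
have [dfd|ndfd] := pselect (d (f d)).
  have /asboolP[g [/fI gd gfd]] := dfd.
  by rewrite gd in gfd; rewrite gfd in dfd.
by apply: (ndfd); apply/asboolP; exists d; split=> //; apply/negbTE/negP.
Qed.

(** * Well-orders *)

Definition well_ordered T (lt : T -> T -> Prop) : Prop :=
  [/\ forall x y z, lt x y -> lt y z -> lt x z,
      forall x, ~ lt x x,
      forall x y, [\/ lt x y, x = y | lt y x] &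
      forall P : set T, P !=set0 -> exists2 x, P x & forall y, P y -> ~ lt y x].

Definition segment T (lt : T -> T -> Prop) (x : T) : Type := {y | lt y x}.

Lemma exists_well_order (T : Type) : exists lt : T -> T -> Prop, well_ordered lt.
Proof.
have [R Rwo] := @well_ordering_principle {classic T}.
have Rm (P : set {classic T}) : P !=set0 -> exists2 x, P x & forall y, P y -> R x y.
  move=> [x Px]; have [|z [[zP zm] _]] := Rwo (fun x => `[< P x >]).
    by exists x; apply/asboolP.
  by exists z; [apply/asboolP|move=> y Py; apply: zm; apply/asboolP].
have Ranti x y : R x y -> R y x -> x = y.
  move=> xy yx; pose A := fun z : {classic T} => (z == x) || (z == y).
  have xx : R x x.
    by have [|z <- zz] := Rm [set x]; [exists x|apply: zz].
  have yy : R y y.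
    by have [|z <- zz] := Rm [set y]; [exists y|apply: zz].
  have [|z [_ zu]] := Rwo A; first by exists x; apply/orP; left.
  rewrite -(zu x) ?(zu y) //; split; try by apply/orP; (left + right).
    by move=> w /orP[/eqP->|/eqP->].
  by move=> w /orP[/eqP->|/eqP->].
have Rtot x y : R x y \/ R y x.
  have [|z [<-|<-] zm] := Rm [set z | x = z \/ y = z]; first by exists x; left.
    by left; apply: zm; right.
  by right; apply: zm; left.
exists (fun x y : {classic T} => R x y /\ x <> y); split.
- move=> x y z [xy nxy] [yz nyz]; split; last first.
    by move=> xz; subst z; apply: nxy; apply: Ranti.
  have [|w [<-|[<-|<-]] wm] := Rm [set w | x = w \/ (y = w \/ z = w)].
  + by exists x; left.
  + by apply: wm; right; right.
  + by case: nxy; apply: Ranti => //; apply: wm; left.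
  + by case: nyz; apply: Ranti => //; apply: wm; right; left.
- by move=> x [_].
- move=> x y; have [->|nxy] := pselect (x = y); first by constructor 2.
  have [xy|yx] := Rtot x y; first by constructor 1.
  by constructor 3; split=> // /esym.
- move=> P /Rm[x Px xm]; exists x => // y Py [yx]; apply; apply: Ranti => //.
  exact: xm.
Qed.

(** A well-order of least possible type: the first segment as large as [T], if
    there is one, lends its order to [T]. *)
Lemma exists_initial_well_order (T : Type) : exists lt : T -> T -> Prop,
  well_ordered lt /\ forall x, ~ embeds T (segment lt x).
Proof.
have [lt [tr irr tri wf]] := exists_well_order T.
have [allS|] := pselect (forall x, ~ embeds T (segment lt x)); first by exists lt.
move=> /existsNP[x0 /contrapT x0T].
have [|x [f fI] xm] := wf [set x | embeds T (segment lt x)]; first by exists x0.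
exists (fun a b => lt (sval (f a)) (sval (f b))); split; first split.
- by move=> a b c; apply: tr.
- by move=> a; apply: irr.
- move=> a b; have [h|h|h] := tri (sval (f a)) (sval (f b)).
  + by constructor 1.
  + by constructor 2; apply: fI; apply: eq_sig_hprop.
  + by constructor 3.
- move=> P [a Pa]; have [|_ [b Pb <-] bm] := wf [set sval (f b) | b in P].
    by exists (sval (f a)), a.
  by exists b => // c Pc; apply: bm; exists c.
- move=> b [g gI]; apply: (xm (sval (f b)) _ (svalP (f b))).
  exists (fun a => exist (fun y => lt y (sval (f b))) _ (svalP (g a))).
  move=> a a' /(congr1 sval) /= h; apply: gI; apply: eq_sig_hprop => //.
  by apply: fI; apply: eq_sig_hprop.
Qed.

Lemma is_succ_cardinal_le (K L M : cardinal) : is_succ_cardinal K L ->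
  ~ embeds L M -> embeds M K.
Proof.
move=> [[KL nLK] Lm] LM; have [//|KM] := embeds_total M K.
have [//|nMK] := pselect (embeds M K).
by case: LM; apply/cardinal_leE/Lm; split; rewrite cardinal_leE.
Qed.

(** In a successor cardinal, a family of at most [K] elements is bounded, since
    otherwise [L] would be a union of [K] segments of size at most [K]. *)
Lemma successor_well_order (K L : cardinal) : embeds nat K ->
  is_succ_cardinal K L -> exists lt : L -> L -> Prop,
  [/\ well_ordered lt, forall x, embeds (segment lt x) K &
      forall (I : Type) (g : I -> L), embeds I K -> exists b, forall i, lt (g i) b].
Proof.
move=> natK KL; have [lt [wo ltL]] := exists_initial_well_order L.
exists lt; have segK x : embeds (segment lt x) K.
  exact: is_succ_cardinal_le KL (ltL x).
split=> // I g IK; apply: contrapT => /forallNP nb.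
have [tr irr tri wf] := wo.
have segK' x : embeds (option (segment lt x)) K.
  have [h hI] := embeds_sum natK (segK x) (embeds_trans embeds_unit natK).
  exists (fun o => h (if o is Some y then inl y else inr tt)).
  by move=> [a|] [b|] /hI // => -[->].
case: KL => -[_ nLK] _; apply: nLK; apply/cardinal_leE.
apply: (@embeds_trans {i : I & option (segment lt (g i))}).
  pose f (u : {i : I & option (segment lt (g i))}) :=
    if projT2 u is Some y then sval y else g (projT1 u).
  apply: (@embeds_quotient _ _ f) => x.
  have /existsNP[i nxi] := nb x.
  have [||] := tri (g i) x => // h; first by exists (existT _ i None).
  by exists (existT _ i (Some (exist _ x h))).
exact: embeds_Sigma natK IK (embeds_refl K) (fun i => segK' (g i)).
Qed.

(** * Countable powers *)

(** When countable sequences are bounded, they all live in proper segments. *)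
Lemma countable_power_of_bounded L (lt : L -> L -> Prop) : embeds nat L ->
  (forall c : nat -> L, exists b, forall n, lt (c n) b) ->
  (forall x, embeds (nat -> segment lt x) L) -> embeds (nat -> L) L.
Proof.
move=> natL bnd seg; apply: (@embeds_trans {b : L & nat -> segment lt b}).
  pose f (u : {b : L & nat -> segment lt b}) n := sval (projT2 u n).
  apply: (@embeds_quotient _ _ f) => c; have [b cb] := bnd c.
  by exists (existT _ b (fun n => exist _ (c n) (cb n))).
exact: embeds_Sigma natL (embeds_refl L) (embeds_refl L) seg.
Qed.

Lemma countable_power_idem A : embeds (nat -> nat -> A) (nat -> A).
Proof.
exists (fun u n => if unpickle n is Some (i, j) then u i j else u 0%N 0%N).
move=> u v uv; apply: funext => i; apply: funext => j.
by have := congr1 (fun w => w (pickle (i, j))) uv; rewrite pickleK.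
Qed.

Lemma is_aleph_infinite n L : is_aleph n L -> embeds nat L.
Proof.
elim: n L => [|n IHn] L /=; first by case/cardinal_eqE.
move=> [K /IHn natK [[/cardinal_leE KL _] _]]; exact: embeds_trans natK KL.
Qed.

(** Hausdorff's formula: a successor has uncountable cofinality, so the identity
    passes from [K] to its successor; and the first aleph that is at least the
    continuum is the continuum itself. *)
Lemma is_aleph_countable_power n (L : cardinal) : is_aleph n L ->
  embeds (nat -> bool) L -> embeds (nat -> L) L.
Proof.
elim: n L => [|n IHn] L /= alephL contL.
  move/cardinal_eqE: alephL => [Lnat _].
  by case: (@Cantor nat); apply: embeds_trans contL Lnat.
have natL : embeds nat L by apply: (@is_aleph_infinite n.+1).
have [K alephK KL] := alephL; have natK := is_aleph_infinite alephK.
have [contK|ncontK] := pselect (embeds (nat -> bool) K).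
  have [lt [_ segK bnd]] := successor_well_order natK KL.
  apply: (@countable_power_of_bounded _ lt) => // [c|x]; first exact: bnd.
  apply: (@embeds_trans (nat -> K)); first exact: embeds_fun.
  apply: embeds_trans (IHn _ alephK contK) _.
  by case: KL => -[/cardinal_leE].
have Lcont : embeds L (nat -> bool).
  case: KL => _ Lm; apply/cardinal_leE/Lm; split; rewrite cardinal_leE //.
  by have [|] := embeds_total K (nat -> bool).
apply: embeds_trans contL.
exact: embeds_trans (embeds_fun _ Lcont) (@countable_power_idem bool).
Qed.

Lemma not_embeds_sum L A B : ~ embeds L nat -> ~ embeds L A -> ~ embeds L B ->
  ~ embeds L (A + B).
Proof.
move=> nLnat nLA nLB LAB.
suff [M [nLM natM AM BM]] : exists M, [/\ ~ embeds L M, embeds nat M,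
    embeds A M & embeds B M].
  by apply: nLM; apply: embeds_trans LAB _; apply: embeds_sum.
have [AB|BA] := embeds_total A B.
  have [Bn|nB] := embeds_total B nat; last by exists B; split=> //; apply: embeds_refl.
  by exists nat; split=> //; [apply: embeds_refl|apply: embeds_trans AB Bn].
have [An|nA] := embeds_total A nat; last by exists A; split=> //; apply: embeds_refl.
by exists nat; split=> //; [apply: embeds_refl|apply: embeds_trans BA An].
Qed.

(** Both cardinal hypotheses of the existence theorem are used through this
    exhaustion.  If [mu^omega < L] for all [mu < L], then it is constant unless
    [L] has countable cofinality. *)
Lemma countable_exhaustion (L : cardinal) : embeds nat L ->
  ([set: nat -> L] #= [set: L] \/
     forall M : cardinal, cardinal_lt M L -> cardinal_lt (nat -> M) L) ->
  exists A : nat -> set L,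
    [/\ forall n x, A n x -> A n.+1 x, forall x, exists n, A n x,
        forall n, embeds nat {x | A n x} &
        forall n, embeds (nat -> {x | A n x}) L].
Proof.
move=> natL; have [iota iotaI] := natL.
have const : embeds (nat -> L) L -> exists A : nat -> set L,
    [/\ forall n x, A n x -> A n.+1 x, forall x, exists n, A n x,
        forall n, embeds nat {x | A n x} &
        forall n, embeds (nat -> {x | A n x}) L].
  move=> LL; exists (fun=> setT); split=> // n.
  - by exists 0%N.
  - by exists (fun i => exist _ (iota i) I) => i j [/iotaI].
  - by apply: embeds_trans LL; apply: embeds_fun; apply: embeds_sub.
case=> [/cardinal_eqE[LL _]|small]; first exact: const.
have smallW (M : cardinal) : ~ embeds L M -> embeds (nat -> M) L.
  move=> LM; have [ML|//] := embeds_total M L.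
  have [|/cardinal_leE //] := small M.
  by split; rewrite cardinal_leE.
have [lt [[tr irr tri wf] ltL]] := exists_initial_well_order L.
have [bnd|] := pselect (forall c : nat -> L, exists b, forall n, lt (c n) b).
  by apply: const; apply: countable_power_of_bounded bnd _ => // x; apply: smallW.
move=> /existsNP[c /forallNP cn].
have nLnat : ~ embeds L nat.
  move=> Lnat; apply: (@Cantor nat).
  suff /smallW boolL : ~ embeds L bool by apply: embeds_trans boolL Lnat.
  move=> /(embeds_trans natL) /infinite_embeds_nat; apply.
  exact: finite_finset.
pose A n : set L := [set x | (exists i, x = iota i) \/
  exists2 m, (m <= n)%N & lt x (c m) \/ x = c m].
exists A; split.
- by move=> n x [?|[m mn xm]]; [left|right; exists m => //; apply: leq_trans mn _].
- move=> x; have /existsNP[n nxn] := cn x; exists n; right; exists n => //.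
  by have [||] := tri (c n) x => //; [right|left].
- by move=> n; exists (fun i => exist _ (iota i) (or_introl (ex_intro _ i erefl)))
     => i j [/iotaI].
have sm1 x : ~ embeds L (option (segment lt x)).
  have : ~ embeds L (segment lt x + unit).
    apply: not_embeds_sum => // Lu; apply: nLnat.
    exact: embeds_trans Lu embeds_unit.
  apply: contra_not => /embeds_trans; apply.
  by exists (fun o => if o is Some y then inl y else inr tt) => -[a|] [b|] // [->].
move=> n; apply: smallW; elim: n => [|n IHn].
  have : ~ embeds L (nat + option (segment lt (c 0%N))) by apply: not_embeds_sum.
  apply: contra_not => /embeds_trans; apply.
  pose f (u : nat + option (segment lt (c 0%N))) := match u with
    | inl i => iota i | inr (Some y) => sval y | inr None => c 0%N end.
  apply: (@embeds_trans {u | A 0%N (f u)}); last exact: embeds_sub.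
  apply: (@embeds_quotient _ _ (fun u => exist (A 0%N) (f (sval u)) (svalP u))).
  move=> [x xA].
  have [u ux] : exists u, f u = x.
    case: (xA) => [[i ->]|[m]]; first by exists (inl i).
    rewrite leqn0 => /eqP-> [h|->]; last by exists (inr None).
    by exists (inr (Some (exist _ x h))).
  subst x; exists (exist _ u xA); exact: eq_sig_hprop.
have : ~ embeds L ({x | A n x} + option (segment lt (c n.+1))) by apply: not_embeds_sum.
apply: contra_not => /embeds_trans; apply.
pose f (u : {x | A n x} + option (segment lt (c n.+1))) := match u with
    | inl i => sval i | inr (Some y) => sval y | inr None => c n.+1 end.
apply: (@embeds_trans {u | A n.+1 (f u)}); last exact: embeds_sub.
apply: (@embeds_quotient _ _ (fun u => exist (A n.+1) (f (sval u)) (svalP u))).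
move=> [x xA].
have [u ux] : exists u, f u = x.
  have [nxA|nxA] := pselect (A n x); first by exists (inl (exist _ x nxA)).
  case: (xA) => [xi|[m]]; first by case: nxA; left.
  rewrite leq_eqVlt => /orP[/eqP->|mn xm]; last by case: nxA; right; exists m.
  by move=> [h|->]; [exists (inr (Some (exist _ x h)))|exists (inr None)].
subst x; exists (exist _ u xA); exact: eq_sig_hprop.
Qed.

(** * Club guessing *)

Lemma well_ordered_rec W (lt : W -> W -> Prop) X
    (F : forall w, (segment lt w -> X) -> X) : well_ordered lt ->
  exists f : W -> X, forall w, f w = F w (fun v => f (sval v)).
Proof.
move=> [tr irr tri wf].
have wfW : well_founded lt.
  move=> w; apply: contrapT => nAcc.
  have [|v nv vm] := wf [set v | ~ Acc lt v]; first by exists w.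
  by apply: nv; constructor=> u uv; apply: contrapT => nu; apply: (vm u nu).
pose G w (u : forall v, lt v w -> X) := F w (fun v => u (sval v) (svalP v)).
exists (Fix wfW (fun=> X) G) => w; rewrite Fix_eq //.
move=> x u v uv; congr F; apply: funext => y; exact: uv.
Qed.

Lemma embeds_bool : embeds bool nat.
Proof. by exists nat_of_bool => -[] []. Qed.

Lemma embeds_False A : embeds False A.
Proof. by exists (fun v : False => match v with end) => -[]. Qed.

Section Closed.
Variables (L K : Type) (lt : L -> L -> Prop).
Hypothesis wo : well_ordered lt.
Hypothesis natK : embeds nat K.
Hypothesis segK : forall x, embeds (segment lt x) K.
Hypothesis bnd : forall (I : Type) (g : I -> L), embeds I K ->
  exists b, forall i, lt (g i) b.

Let lt_trans x y z : lt x y -> lt y z -> lt x z.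
Proof. by case: wo => tr _ _ _; apply: tr. Qed.
Let wf (P : set L) : P !=set0 -> exists2 x, P x & forall y, P y -> ~ lt y x.
Proof. by case: wo => _ _ _; apply. Qed.
Let lt_le_trans x y z : lt x y -> ~ lt z y -> lt x z.
Proof.
move=> xy zy; have [_ _ tri _] := wo.
by have [|<-|] := tri y z => // yz; apply: lt_trans xy yz.
Qed.
Let le_lt_trans x y z : ~ lt y x -> lt y z -> lt x z.
Proof.
move=> yx yz; have [_ _ tri _] := wo.
by have [|<-|] := tri y x => // xy; apply: lt_trans xy yz.
Qed.

(** The points closed under [h] form a club, and every club of a regular
    uncountable [L] contains one of this form: functions thus stand for clubs,
    and pointwise bounds for their intersections. *)
Definition closed_under (h : L -> L) (x : L) : Prop :=
  forall y, lt y x -> lt (h y) x.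

Lemma closed_under_le h h' x : (forall y, lt (h y) (h' y)) ->
  closed_under h' x -> closed_under h x.
Proof. by move=> hh' xh' y /xh'; apply: lt_trans. Qed.

(** The least upper bound of the closed points below [x] is closed. *)
Lemma exists_last_closed h x : exists e, [/\ closed_under h e, ~ lt x e &
  forall e', closed_under h e' -> ~ lt x e' -> ~ lt e e'].
Proof.
have [|s Ps sm] := wf (P := [set u |
  forall e, closed_under h e -> ~ lt x e -> ~ lt u e]).
  by exists x => e _.
exists s; split=> //; last by apply: sm => e.
move=> y ys; have /existsNP[e /not_implyP[he /not_implyP[xe /contrapT ye]]] :=
  (fun Py => sm y Py ys).
by apply: lt_le_trans (he _ ye) _; apply: Ps.
Qed.

Definition last_closed h x : L := projT1 (cid (exists_last_closed h x)).

Lemma last_closedP h x : [/\ closed_under h (last_closed h x),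
  ~ lt x (last_closed h x) &
  forall e, closed_under h e -> ~ lt x e -> ~ lt (last_closed h x) e].
Proof. exact: projT2 (cid (exists_last_closed h x)). Qed.

Definition cofinal_in (d : L) (c : nat -> L) : Prop :=
  (forall n, lt (c n) d) /\ forall y, lt y d -> exists n, ~ lt (c n) y.

Lemma exists_sup (c : nat -> L) : exists d, cofinal_in d c.
Proof.
have [d cd dm] := wf (P := [set d | forall n, lt (c n) d]) (bnd c natK).
by exists d; split=> // y yd; apply/existsNP => cy; apply: (dm y).
Qed.

Lemma exists_closed_above h x : exists e, closed_under h e /\ lt x e.
Proof.
have next y : exists b, lt y b /\ forall z, lt z y -> lt (h z) b.
  have [b1 hb1] := bnd (fun z : segment lt y => h (sval z)) (segK y).
  have [b hb] := bnd (fun i : bool => if i then y else b1)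
    (embeds_trans embeds_bool natK).
  exists b; split; first exact: (hb true).
  by move=> z zy; apply: lt_trans (hb false); apply: (hb1 (exist _ z zy)).
have [f fP] := choice next; pose c n := iter n f x.
have [d [cd dm]] := exists_sup c; exists d; split; last exact: (cd 0%N).
move=> y /dm[n yn]; have [cn _] := fP (c n); have [_ hn] := fP (c n.+1).
apply: lt_trans (cd n.+2); apply: hn; exact: le_lt_trans yn cn.
Qed.

Variables (W : Type) (ltW : W -> W -> Prop).
Hypothesis woW : well_ordered ltW.
Hypothesis bndW : forall c : nat -> W, exists b, forall n, ltW (c n) b.
Hypothesis WK : embeds W K.
Variable w0 : W.

(** Iterate along the uncountable [W]: if no [h] made the points
    [last_closed h (c0 d n)] guess all clubs, a counterexample club could be
    chosen at each stage and put into the next one.  Along the iteration each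
    [last_closed _ (c0 d n)] can only decrease, hence is eventually constant,
    for all [n] at once since countable subsets of [W] are bounded: a
    stage that nothing changes any more guesses its own counterexample. *)
Lemma exists_guessing_function (c0 : L -> nat -> L) :
  (forall d c, cofinal_in d c -> cofinal_in d (c0 d)) ->
  exists h, forall h', exists d,
    (exists s : nat -> nat, forall n,
       lt (last_closed h (c0 d (s n))) (last_closed h (c0 d (s n.+1)))) /\
    forall n, closed_under h' (last_closed h (c0 d n)).
Proof.
move=> c0P; apply: contrapT => /forallNP noh.
have bad h : exists h', forall d,
    (exists s : nat -> nat, forall n,
       lt (last_closed h (c0 d (s n))) (last_closed h (c0 d (s n.+1)))) ->
    exists n, ~ closed_under h' (last_closed h (c0 d n)).
  have /existsNP[h' /forallNP nh'] := noh h; exists h' => d sd.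
  by apply/existsNP => hd; apply: (nh' d).
have [Phi PhiP] := choice bad.
have [trW irrW triW wfW] := woW.
have step (w : W) (u : segment ltW w -> L -> L) : exists h : L -> L, forall v x,
    lt (u v x) (h x) /\ lt (Phi (u v) x) (h x).
  suff [h hP] : {h : L -> L & forall x v,
      lt (u v x) (h x) /\ lt (Phi (u v) x) (h x)} by exists h.
  apply: (@choice _ _ (fun x b => forall v, lt (u v x) b /\ lt (Phi (u v) x) b)) => x.
  have segWK : embeds (segment ltW w) K by apply: embeds_trans WK; apply: embeds_sub.
  have pairK : embeds (segment ltW w * bool) K.
    have [iota iotaI] := natK; apply: embeds_trans (embeds_square iotaI).
    exact: embeds_prod segWK (embeds_trans embeds_bool natK).
  have [b bP] := bnd (fun i : segment ltW w * bool =>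
    if i.2 then u i.1 x else Phi (u i.1) x) pairK.
  by exists b => v; split; [apply: (bP (v, true))|apply: (bP (v, false))].
have [hs hsE] := well_ordered_rec
  (fun w u => projT1 (cid (step w u))) woW.
have hsP w v : ltW v w -> forall x, lt (hs v x) (hs w x) /\ lt (Phi (hs v) x) (hs w x).
  move=> vw x; rewrite (hsE w).
  by case: cid => h /= /(_ (exist _ v vw) x).
have [hM hMP] : {hM : L -> L & forall x w, lt (hs w x) (hM x)}.
  by apply: (@choice _ _ (fun x b => forall w, lt (hs w x) b)) => x; apply: bnd.
have [e0 _] := bnd (fun v : False => match v with end) (embeds_False K).
have [f fP] := choice (exists_closed_above hM).
pose e n := iter n.+1 f e0.
have eM n : closed_under hM (e n) by have [] := fP (iter n f e0).
have e_lt n : lt (e n) (e n.+1) by have [] := fP (e n).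
have [d de] := exists_sup e; have [cd dc] := c0P _ _ de.
case: de => ed de; set c := c0 d in cd dc.
have [ws wsP] : {ws : nat -> W & forall n w, ~ ltW w (ws n) ->
    last_closed (hs w) (c n) = last_closed (hs (ws n)) (c n)}.
  apply: (@choice _ _ (fun n v => forall w, ~ ltW w v ->
    last_closed (hs w) (c n) = last_closed (hs v) (c n))) => n.
  have [|_ [v _ <-] vm] := wf (P := range (fun w => last_closed (hs w) (c n))).
    by exists (last_closed (hs w0) (c n)), w0.
  exists v => w nwv; have [vw|->|] := triW v w => //.
  have [_ _ tri _] := wo.
  have [hw wc _] := last_closedP (hs w) (c n).
  have [_ _ vlast] := last_closedP (hs v) (c n).
  have [wv|//|vw'] := tri (last_closed (hs w) (c n)) (last_closed (hs v) (c n)).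
    by case: (vm (last_closed (hs w) (c n))) => //; exists w.
  case: (vlast (last_closed (hs w) (c n))) => //.
  by apply: closed_under_le hw => y; have [] := hsP _ _ vw y.
have [w1 w1P] := bndW ws; have [w2 w12] := bndW (fun=> w1).
have stable n : last_closed (hs w2) (c n) = last_closed (hs w1) (c n).
  rewrite !wsP // => h; first exact: irrW (trW _ _ _ h (w1P n)).
  exact: irrW (trW _ _ _ h (trW _ _ _ (w1P n) (w12 0%N))).
have closed1 x : closed_under hM x -> closed_under (hs w1) x.
  by apply: closed_under_le => y; apply: hMP.
have cof y : lt y d -> exists m, lt y (last_closed (hs w1) (c m)).
  move=> /de[k yk]; have [m cm] := dc _ (ed k.+1); exists m.
  apply: le_lt_trans yk _; apply: lt_le_trans (e_lt k) _.
  by have [_ _] := last_closedP (hs w1) (c m); apply=> //; apply: closed1.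
have [|n nP] := PhiP (hs w1) d.
  have next m : exists m', lt (last_closed (hs w1) (c m)) (last_closed (hs w1) (c m')).
    apply: cof; apply: le_lt_trans (cd m).
    by have [] := last_closedP (hs w1) (c m).
  by have [s sP] := choice next; exists (fun n => iter n s 0%N) => n; apply: sP.
apply: nP; rewrite -/c -stable.
have [+ _ _] := last_closedP (hs w2) (c n).
by apply: closed_under_le => y; have [] := hsP _ _ (w12 0%N) y.
Qed.

Lemma exists_guessing_sequences : exists C : L -> nat -> L, forall h,
  exists d, (forall n, lt (C d n) (C d n.+1)) /\
            forall n, closed_under h (C d n).
Proof.
have [x0 _] := bnd (fun v : False => match v with end) (embeds_False K).
have c0E d : exists c0, forall c, cofinal_in d c -> cofinal_in d c0.
  have [[c dc]|nc] := pselect (exists c, cofinal_in d c); first by exists c.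
  by exists (fun=> x0) => c dc; case: nc; exists c.
have [c0 c0P] := choice c0E.
have [h hP] := exists_guessing_function c0P.
pose inc d (s : nat -> nat) := forall n,
  lt (last_closed h (c0 d (s n))) (last_closed h (c0 d (s n.+1))).
have sE d : exists s, (exists t, inc d t) -> inc d s.
  have [[t dt]|nt] := pselect (exists t, inc d t); first by exists t.
  by exists id => /nt.
have [s sP] := choice sE.
exists (fun d n => last_closed h (c0 d (s d n))) => h'.
by have [d [/sP sd dh']] := hP h'; exists d; split.
Qed.

End Closed.

Local Open Scope ring_scope.

(** * Subgroups and quotients *)

Definition subgroup (V : zmodType) (S : set V) : Prop :=
  S 0 /\ forall x y, S x -> S y -> S (x - y).

Section SubgroupTheory.
Variables (V : zmodType) (S : set V).

Lemma subgroup_zmod_closed : subgroup S <-> zmod_closed [in S].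
Proof.
split=> [[S0 SB]|[S0 SB]]; split.
- exact: mem_set.
- by move=> x y /set_mem Sx /set_mem Sy; apply/mem_set/SB.
- exact: set_mem.
- by move=> x y Sx Sy; apply/set_mem/SB; apply: mem_set.
Qed.

Hypothesis SS : subgroup S.

Lemma subgroup0 : S 0. Proof. by case: SS. Qed.
Lemma subgroupB x y : S x -> S y -> S (x - y). Proof. by case: SS => _; apply. Qed.
Lemma subgroupN x : S x -> S (- x).
Proof. by move=> Sx; rewrite -sub0r; apply: subgroupB => //; apply: subgroup0. Qed.
Lemma subgroupD x y : S x -> S y -> S (x + y).
Proof. by move=> Sx /subgroupN Sy; rewrite -[y]opprK; apply: subgroupB. Qed.
Lemma subgroupMn x n : S x -> S (x *+ n).
Proof.
move=> Sx; elim: n => [|n IHn]; first exact: subgroup0.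
by rewrite mulrS; apply: subgroupD.
Qed.
Lemma subgroupMz x (i : int) : S x -> S (x *~ i).
Proof.
case: i => n Sx; first exact: subgroupMn.
by rewrite NegzE mulrNz; apply/subgroupN/subgroupMn.
Qed.

Definition subgroup_pred of subgroup S : {pred V} := [in S].
Let subgroup_predP : zmod_closed (subgroup_pred SS).
Proof. exact/subgroup_zmod_closed. Qed.
HB.instance Definition _ :=
  GRing.isZmodClosed.Build V (subgroup_pred SS) subgroup_predP.
Record subgroup_type :=
  SubgroupElt {subgroup_val : V; _ : subgroup_val \in subgroup_pred SS}.
HB.instance Definition _ := [isSub for subgroup_val].
HB.instance Definition _ := [Choice of subgroup_type by <:].
HB.instance Definition _ := [SubChoice_isSubZmodule of subgroup_type by <:].

Lemma exists_subgroup_type : exists (G : zmodType) (i : {additive G -> V}),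
  injective i /\ range i = S.
Proof.
exists subgroup_type, (val : {additive subgroup_type -> V}); split.
  exact: val_inj.
apply/seteqP; split=> x.
  by move=> [[y Sy] _ <-]; apply: set_mem Sy.
by move=> Sx; exists (SubgroupElt (mem_set Sx : x \in subgroup_pred SS)).
Qed.

End SubgroupTheory.

(** The localization of the integers at [p], phrased without denominators so
    that closure under subtraction is immediate. *)
Definition local_rat (p : nat) : {pred rat} :=
  fun x => `[< exists n (z : int), coprime p n /\ x *+ n = z%:~R >].

Lemma local_rat_closed p : zmod_closed (local_rat p).
Proof.
split=> [|x y /asboolP[n [a [pn xa]]] /asboolP[m [b [pm yb]]]]; apply/asboolP.
  by exists 1%N, 0; rewrite coprimen1 mul0rn.
exists (n * m)%N, (a *+ m - b *+ n); split; first by rewrite coprimeMr pn.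
by rewrite mulrnBl mulrnA xa mulnC mulrnA yb rmorphB !rmorphMn.
Qed.
HB.instance Definition _ p :=
  GRing.isZmodClosed.Build rat (local_rat p) (local_rat_closed p).

(** The Pruefer group, as the quotient of the rationals by their localization
    at [p]. *)
Lemma exists_prufer (p : nat) : prime p -> exists (D : zmodType) (zeta : D),
  [/\ forall (x : D) m, (0 < m)%N -> exists y, y *+ m = x,
      forall x : D, exists k, x *+ (p ^ k)%N = 0,
      zeta <> 0, zeta *+ p = 0 & embeds D nat].
Proof.
move=> pP; pose D : zmodType := Quotient.quot (local_rat p).
pose pr : {additive rat -> D} := \pi_D%qT.
have prK (x : D) : pr (repr x) = x by apply: reprK.
have pr0 x : pr x = 0 <-> x \in local_rat p.
  by rewrite -{2}[x]subr0 Quotient.idealrBE -(raddf0 pr); split=> [->|/eqP].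
have p0 : (p%:R : rat) != 0 by rewrite Num.Theory.pnatr_eq0 -lt0n prime_gt0.
have divK (x : rat) m : (0 < m)%N -> (x / m%:R) *+ m = x.
  by move=> m0; rewrite -(mulr_natr (x / m%:R)) mulfVK // Num.Theory.pnatr_eq0 -lt0n.
exists D, (pr (1 / p%:R)); split.
- move=> x m m0; exists (pr (repr x / m%:R)).
  by rewrite -raddfMn divK ?prK.
- move=> x; pose n := `|denq (repr x)|%N.
  have n0 : (0 < n)%N by rewrite absz_gt0 denq_neq0.
  exists (logn p n); rewrite -[x]prK -raddfMn; apply/pr0/asboolP.
  exists (n`_(p^'))%N, (numq (repr x)); split.
    by rewrite prime_coprime // -p'natE // part_pnat.
  rewrite -mulrnA -p_part partnC // -(mulr_natr (repr x)) numqE.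
  by congr (_ * _); rewrite -[X in X%:~R]absz_denq.
- move/pr0/asboolP => [n [z [pn /(congr1 (fun x => x * p%:R))]]].
  rewrite mulrnAl divrK // ?unitfE // !pmulrn -intrM => /intr_inj nz.
  have : (p %| n)%N by apply/dvdnP; exists `|z|%N; rewrite -[n]/(`|n%:Z|%N) nz abszM.
  by move: pn; rewrite prime_coprime // => /negbTE ->.
- rewrite -raddfMn divK ?prime_gt0 //; apply/pr0/asboolP; exists 1%N, 1.
  by rewrite coprimen1.
- exists (fun x => pickle (repr x)) => x y /(pcan_inj pickleK) xy.
  by rewrite -[x]reprK xy reprK.
Qed.

(** * Partial homomorphisms *)

Section PartialHom.
Variables (G A : zmodType).
Implicit Types (H : set (G * A)) (x v : G) (c a : A).

Lemma pair_subE x v c a : (x, c) - (v, a) = (x - v, c - a) :> G * A.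
Proof. by []. Qed.

Lemma pair_mulrzE x c (i : int) : (x, c) *~ i = (x *~ i, c *~ i) :> G * A.
Proof.
have pairMn n : (x, c) *+ n = (x *+ n, c *+ n) :> G * A.
  by elim: n => [|n IHn] //; rewrite !mulrS IHn.
by case: i => n; [exact: pairMn|rewrite !NegzE !mulrNz -![_ *~ Posz _]/(_ *+ _) pairMn].
Qed.

(** Partial homomorphisms are handled as graphs: a chain of them then has its
    union as an upper bound. *)
Definition partial_hom H : Prop := subgroup H /\ forall c, H (0, c) -> c = 0.

Definition domain H : set G := [set x | exists c, H (x, c)].

Lemma partial_hom_fun H x c c' : partial_hom H -> H (x, c) -> H (x, c') -> c = c'.
Proof.
move=> [SH H0] Hc Hc'; apply/subr0_eq/H0.
by have := subgroupB SH Hc Hc'; rewrite pair_subE subrr.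
Qed.

Lemma domain_subgroup H : partial_hom H -> subgroup (domain H).
Proof.
move=> [SH _]; split; first by exists 0; apply: (subgroup0 SH).
move=> x y [c Hx] [d Hy]; exists (c - d); rewrite -pair_subE; exact: subgroupB.
Qed.

Definition adjoin H v a : set (G * A) :=
  [set u | exists x c (i : int), H (x, c) /\ u = (x + v *~ i, c + a *~ i)].

Lemma sub_adjoin H v a : H `<=` adjoin H v a.
Proof. by move=> [x c] Hx; exists x, c, 0; rewrite !mulr0z !addr0. Qed.

Lemma domain_adjoin H v a : subgroup H -> domain (adjoin H v a) v.
Proof.
move=> SH; exists a, 0, 0, 1; rewrite !mulr1z !add0r; split=> //.
exact: (subgroup0 SH).
Qed.

(** Well-definedness of the extension needs checking only on the multiples of
    [v] that are already in the domain, and [v *+ m] generates these. *)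
Lemma partial_hom_adjoin H v a (m : nat) : partial_hom H ->
  (forall i : int, domain H (v *~ i) -> exists j, i = (m : int) * j) ->
  H (v *+ m, a *+ m) ->
  partial_hom (adjoin H v a).
Proof.
move=> pH vm Hvm; have [SH H0] := pH; split; first split.
- by exists 0, 0, 0; rewrite !mulr0z !addr0; split=> //; apply: (subgroup0 SH).
- move=> _ _ [x [c [i [Hx ->]]]] [y [d [j [Hy ->]]]].
  exists (x - y), (c - d), (i - j); split; first by rewrite -pair_subE; apply: subgroupB.
  by rewrite !mulrzBr pair_subE !opprD; congr (_, _); rewrite addrACA.
- move=> _ [x [c [i [Hx [/esym /eqP + ->]]]]].
  rewrite addr_eq0 => /eqP xv.
  have [j ij] : exists j, i = m%:Z * j.
    apply: vm; exists (- c); rewrite -[v *~ i]opprK -xv.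
    by have := subgroupB SH (subgroup0 SH) Hx; rewrite pair_subE !sub0r.
  have := subgroupMz SH (- j) Hvm.
  have -> : (v *+ m, a *+ m) *~ - j = (x, - (a *~ i)).
    rewrite pair_mulrzE xv ij; congr (_, _).
      by rewrite mulrNz mulrzA.
    by rewrite mulrNz mulrzA.
  by move=> /(partial_hom_fun pH Hx) ->; rewrite addNr.
Qed.
(** The constraint [Q] serves to keep control of kernels and supports while new
    elements are added one at a time. *)
Lemma partial_hom_extend (Q : set (set (G * A))) (V : set G) H0 :
  (forall F : set (set (G * A)), F `<=` Q -> F !=set0 -> total_on F subset ->
     Q (\bigcup_(X in F) X)) ->
  partial_hom H0 -> Q H0 ->
  (forall H v, partial_hom H -> Q H -> H0 `<=` H -> V v -> ~ domain H v ->
     exists H', [/\ partial_hom H', Q H', H `<=` H' & domain H' v]) ->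
  exists H, [/\ partial_hom H, Q H, H0 `<=` H & V `<=` domain H].
Proof.
move=> QU pH0 QH0 step.
have [|F FP [X0 FX0] Ftot|H [[pH QH] H0H Hmax]] :=
    @Zorn_above _ (fun H => partial_hom H /\ Q H) H0; first by [].
  split; last first.
    by apply: QU => //; [move=> X /FP[]|exists X0].
  split; first split.
  - by exists X0 => //; have [[SX _] _] := FP _ FX0; apply: (subgroup0 SX).
  - move=> x y [X FX Xx] [Y FY Yy].
    have [XY|YX] := Ftot _ _ FX FY.
      exists Y => //; have [[SY _] _] := FP _ FY; apply: (subgroupB SY) => //; exact: XY.
    exists X => //; have [[SX _] _] := FP _ FX; apply: (subgroupB SX) => //; exact: YX.
  - by move=> c [X FX Xc]; have [[_ X0c] _] := FP _ FX; apply: X0c.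
exists H; split=> // v Vv; apply: contrapT => nv.
have [H' [pH' QH' HH' [c H'v]]] := step H v pH QH H0H Vv nv.
by apply: nv; exists c; apply: (Hmax H').
Qed.

End PartialHom.

Section FunctionValues.
Variables (T : Type) (A : zmodType).
Implicit Types (f g : T -> A).

Lemma fctBE f g t : (f - g) t = f t - g t. Proof. by []. Qed.
Lemma fctMnE f n t : (f *+ n) t = f t *+ n.
Proof. by elim: n => [|n IHn] //; rewrite !mulrS -IHn. Qed.
Lemma fctMzE f (i : int) t : (f *~ i) t = f t *~ i.
Proof.
case: i => n; first exact: fctMnE.
by rewrite !NegzE !mulrNz; exact: (congr1 -%R (fctMnE f n.+1 t)).
Qed.

Definition single t a : T -> A := fun t' => if `[< t' = t >] then a else 0.

Lemma single_id t a : single t a t = a.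
Proof. by rewrite /single; case: asboolP. Qed.

Lemma single_neq t t' a : single t a t' <> 0 -> t' = t.
Proof. by rewrite /single; case: asboolP. Qed.

Definition finsupp (S : set T) : set (T -> A) :=
  [set f | finite_set [set t | f t <> 0] /\ forall t, f t <> 0 -> S t].

Lemma finsupp_subgroup S : subgroup (finsupp S).
Proof.
split; first by split=> // ; apply: sub_finite_set (finite_set0 T) => t.
move=> f g [ff fS] [gf gS]; have fg t : (f - g) t <> 0 -> f t <> 0 \/ g t <> 0.
  rewrite fctBE => fgt; have [ft0|] := pselect (f t = 0); last by left.
  by right=> gt0; apply: fgt; rewrite ft0 gt0 subrr.
split; last by move=> t /fg[/fS|/gS].
apply: sub_finite_set (_ : finite_set ([set t | f t <> 0] `|` [set t | g t <> 0])) => //.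
by rewrite finite_setU.
Qed.

Lemma finsupp_single S t a : S t -> finsupp S (single t a).
Proof.
move=> St; split; last by move=> t' /single_neq ->.
by apply: sub_finite_set (finite_set1 t) => t' /single_neq.
Qed.

End FunctionValues.

(** By Bezout: the integers [i] with [v *~ i] in [S] form an ideal, proper since
    [v] is not in [S], that contains the prime [p]. *)
Lemma prime_subgroup_dvd (V : zmodType) (S : set V) (v : V) (p : nat) (i : int) :
  prime p -> subgroup S -> S (v *+ p) -> S (v *~ i) -> ~ S v ->
  exists j, i = p%:Z * j.
Proof.
move=> pP SS Sp Si Sv; have [/dvdzP[j ->]|npi] := boolP (p %| i)%Z.
  by exists j; rewrite mulrC.
have /coprimezP[[a b] /= ab] : coprimez i p.
  rewrite /coprimez /gcdz absz_nat -[_ == _]/(coprime `|i| p).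
  by rewrite coprime_sym prime_coprime.
case: Sv; rewrite -[v]mulr1z -ab mulrzDr [a * _]mulrC [b * _]mulrC !mulrzA.
by apply: (subgroupD SS); apply: (subgroupMz SS).
Qed.

Section Separating.
Variables (L : Type) (D : zmodType) (zeta : D) (p : nat).
Hypothesis pP : prime p.
Hypothesis div : forall (x : D) m, (0 < m)%N -> exists y, y *+ m = x.
Hypothesis zeta0 : zeta <> 0.
Hypothesis zetap : zeta *+ p = 0.

Variables (G : zmodType) (V W : set G) (e : G -> L) (S : set L).
Hypothesis torsion : forall x : G, exists2 m, (0 < m)%N & x *+ m = 0.
Hypothesis SW : subgroup W.
Hypothesis VW : forall x, V x -> W (x *+ p).
Hypothesis eI : forall x y, V x -> V y -> e x = e y -> x = y.
Hypothesis eS : forall x, V x -> S (e x).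

(** The images of [v] outside the domain are new coordinates: sending [v] to the
    element of order [p] there keeps the kernel equal to [W]. *)
Lemma exists_separating_partial_hom : exists H : set (G * (L -> D)),
  [/\ partial_hom H, forall x c, H (x, c) -> finsupp S c,
     forall x, W x -> H (x, 0), forall x, H (x, 0) -> W x & V `<=` domain H].
Proof.
pose Q (H : set (G * (L -> D))) := forall x c, H (x, c) -> [/\ c = 0 -> W x,
  finsupp S c & forall l, c l <> 0 -> exists v, [/\ V v, domain H v & l = e v]].
pose H0 : set (G * (L -> D)) := [set u | W u.1 /\ u.2 = 0].
have [F FQ _ _ x c [X FX Xx]|||H v pH QH H0H Vv nv|H [pH QH H0H VH]] :=
  @partial_hom_extend G (L -> D) Q V H0.
- have [Xc0 cf cs] := FQ _ FX _ _ Xx; split=> // l /cs[v [Vv [d Xv] ->]].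
  by exists v; split=> //; exists d, X.
- split; first split; first by split=> //; apply: (subgroup0 SW).
    move=> [x c] [y d] [/= Wx ->] [/= Wy ->].
    by split; [apply: subgroupB|rewrite /= subrr].
  by move=> c [].
- move=> x c [/= Wx ->]; split=> //; exact: (subgroup0 (finsupp_subgroup D S)).
- pose a := single (e v) zeta.
  have [SH Hfun] := pH; have Sdom := domain_subgroup pH.
  have dompv : domain H (v *+ p) by exists 0; apply: H0H; split=> //; apply: VW.
  have ap : a *+ p = 0.
    apply: funext => l; rewrite fctMnE /a /single; case: ifP => _ //.
    exact: mul0rn.
  exists (adjoin H v a); split; last exact: domain_adjoin.
  + apply: (@partial_hom_adjoin _ _ _ _ _ p) => // [i domi|].
      exact: (prime_subgroup_dvd pP Sdom dompv domi nv).
    by rewrite ap; apply: H0H; split=> //; apply: VW.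
  + move=> _ _ [x [c [i [Hx [-> ->]]]]]; have [c0 cf cs] := QH _ _ Hx; split.
    * move=> ca0; have cev : c (e v) = 0.
        apply: contrapT => /cs[v' [Vv' dv' evv']].
        by apply: nv; rewrite (eI Vv Vv' evv').
      have zi : zeta *~ i = 0.
        have := congr1 (fun f => f (e v)) ca0.
        rewrite /= -[X in X = _]/(c (e v) + (a *~ i) (e v)).
        by rewrite cev add0r fctMzE /a single_id.
      have [||||j ij] := @prime_subgroup_dvd D [set 0] zeta p i pP => //.
        by split=> // y z -> ->; rewrite subrr.
      have ai : a *~ i = 0 by rewrite ij mulrzA -[a *~ p]/(a *+ p) ap mul0rz.
      apply: (subgroupD SW); first by apply: c0; move: ca0; rewrite ai addr0.
      by rewrite ij mulrzA; apply: (subgroupMz SW); apply: VW.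
    * apply: (subgroupD (finsupp_subgroup D S)) => //.
      apply: (subgroupMz (finsupp_subgroup D S)).
      by apply: finsupp_single; apply: eS.
    * move=> l; have [cl|/cs[v' [Vv' [d dv'] ->]] _] := pselect (c l = 0); last first.
        by exists v'; split=> //; exists d; apply: sub_adjoin.
      rewrite -[_ l]/(c l + (a *~ i) l) cl add0r fctMzE => al.
      exists v; split=> //; first exact: domain_adjoin.
      apply: (@single_neq _ _ _ _ zeta) => al0.
      by apply: al; rewrite /a al0; exact: mul0rz.
  + exact: sub_adjoin.
exists H; split=> // [x c /QH[]|x Wx|x /QH[W0 _ _]] //; first exact: H0H.
exact: W0.
Qed.

(** Divisibility of the coefficients then extends the map to [G] (Baer). *)
Lemma exists_separating_map : exists f : G -> L -> D,
  [/\ zmod_morphism f, forall x, finsupp S (f x), forall x, W x -> f x = 0 &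
      forall x, V x -> f x = 0 -> W x].
Proof.
have [H0 [pH0 H0S WH0 H0W VH0]] := exists_separating_partial_hom.
pose Q (H : set (G * (L -> D))) := forall x c, H (x, c) -> finsupp S c.
have [F FQ _ _ x c [X FX Xx]|||H v pH QH H0H _ nv|H [pH QH H0H HT]] :=
  @partial_hom_extend G (L -> D) Q setT H0 => //; first exact: FQ Xx.
- have Sdom := domain_subgroup pH.
  have exm : exists m, `[< (0 < m)%N /\ domain H (v *+ m) >].
    have [m m0 vm] := torsion v; exists m; apply/asboolP; split=> //.
    by rewrite vm; apply: (subgroup0 Sdom).
  case: (ex_minnP exm) => m /asboolP[m0 [c Hc]] mmin.
  have [cf cS] := QH _ _ Hc.
  have [r rP] : {r : L -> D & forall l, r l *+ m = c l /\ (c l = 0 -> r l = 0)}.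
    apply: (@choice _ _ (fun l y => y *+ m = c l /\ (c l = 0 -> y = 0))) => l.
    have [->|cl] := pselect (c l = 0); first by exists 0; rewrite mul0rn.
    by have [y ym] := div (c l) m0; exists y; split=> // /cl.
  have rm : r *+ m = c by apply: funext => l; rewrite fctMnE; have [] := rP l.
  have rc l : r l <> 0 -> c l <> 0 by move=> rl cl; apply: rl; apply: (rP l).2.
  exists (adjoin H v r); split.
  + apply: (@partial_hom_adjoin _ _ _ _ _ m) => // [i domi|]; last by rewrite rm.
    exists (i %/ m)%Z; rewrite {1}(divz_eq i m) mulrC.
    suff -> : (i %% m)%Z = 0 by rewrite addr0.
    have im0 : (0 <= i %% m)%Z by rewrite modz_ge0 // -lt0n.
    have imm : (i %% m < m)%Z by rewrite ltz_pmod.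
    have domim : domain H (v *~ (i %% m)%Z).
      rewrite (_ : (i %% m)%Z = i - m%:Z * (i %/ m)%Z); last first.
        by rewrite {2}(divz_eq i m) mulrC addrC addKr.
      rewrite mulrzBr mulrzA; apply: subgroupB => //.
      by apply: (subgroupMz Sdom); exists c.
    case: (i %% m)%Z im0 imm domim => // -[//|k] _ km domk.
    have /mmin : `[< (0 < k.+1)%N /\ domain H (v *+ k.+1) >] by apply/asboolP.
    by move: km; rewrite ltz_nat ltnNge => /negbTE ->.
  + move=> _ _ [x [d [i [Hx [_ ->]]]]].
    apply: (subgroupD (finsupp_subgroup D S)); first exact: QH Hx.
    apply: (subgroupMz (finsupp_subgroup D S)); split; last by move=> l /rc/cS.
    by apply: sub_finite_set cf => l /rc.
  + exact: sub_adjoin.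
  + by apply: domain_adjoin; case: pH.
have [f fH] := choice (fun x => HT x I).
have f_unique x c : H (x, c) -> f x = c by apply: partial_hom_fun (fH x).
exists f; split=> [x y|x|x Wx|x /VH0[c H0x] fx0].
- by apply: f_unique; rewrite -pair_subE; apply: (subgroupB (proj1 pH)).
- exact: QH (fH x).
- by apply: f_unique; apply/H0H/WH0.
- by apply: H0W; rewrite -fx0 (f_unique x c) //; apply: H0H.
Qed.

End Separating.

(** * Ladder groups *)

Section Ladder.
Variables (L : Type) (D : zmodType) (zeta : D) (p : nat).
Hypothesis pP : prime p.
Hypothesis div : forall (x : D) m, (0 < m)%N -> exists y, y *+ m = x.
Hypothesis zeta0 : zeta <> 0.
Hypothesis zetap : zeta *+ p = 0.

Definition ladder (S : set L) : set (nat -> L -> D) :=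
  [set g | [/\ forall k, finsupp S (g k), forall k, g k.+1 *+ (p ^ k.+1)%N = 0 &
               exists n, g *+ (p ^ n)%N = 0]].

Lemma mulrn_pexp_le (V : zmodType) (x : V) m n :
  (m <= n)%N -> x *+ (p ^ m)%N = 0 -> x *+ (p ^ n)%N = 0.
Proof. by move=> mn x0; rewrite -(subnKC mn) expnD mulrnA x0 mul0rn. Qed.

Lemma ladder_subgroup S : subgroup (ladder S).
Proof.
split; first split.
- by move=> k; apply: (subgroup0 (finsupp_subgroup D S)).
- by move=> k; rewrite mul0rn.
- by exists 0%N; rewrite mul0rn.
move=> f g [fS fk [m fm]] [gS gk [n gn]]; split.
- by move=> k; apply: (subgroupB (finsupp_subgroup D S)).
- by move=> k; rewrite fctBE mulrnBl fk gk subrr.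
- exists (maxn m n); rewrite mulrnBl.
  by rewrite (mulrn_pexp_le (leq_maxl m n)) ?(mulrn_pexp_le (leq_maxr m n)) ?subrr.
Qed.

Section LadderMap.
Variables (G : zmodType) (K N : set G) (e : G -> L) (S : set L).
Hypothesis Gp : forall x : G, exists k, x *+ (p ^ k)%N = 0.
Hypothesis SK : subgroup K.
Hypothesis SN : subgroup N.
Hypothesis KN : K `<=` N.
Hypothesis Npure : forall x k, N (x *+ (p ^ k)%N) ->
  exists2 y, N y & y *+ (p ^ k)%N = x *+ (p ^ k)%N.
Hypothesis eI : forall x y, N x -> N y -> e x = e y -> x = y.
Hypothesis eS : forall x, N x -> S (e x).

Let mulp (T : set G) k : set G :=
  [set x | exists a y, [/\ K a, T y & x = a + y *+ (p ^ k)%N]].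

Let mulp_subgroup T k : subgroup T -> subgroup (mulp T k).
Proof.
move=> ST; split.
  exists 0, 0; rewrite mul0rn addr0.
  by split=> //; [apply: (subgroup0 SK)|apply: (subgroup0 ST)].
move=> _ _ [a [x [Ka Tx ->]]] [b [y [Kb Ty ->]]].
exists (a - b), (x - y); split; [exact: subgroupB|exact: subgroupB|].
by rewrite mulrnBl opprD addrACA.
Qed.

(** The socle of [N / K], filtered by heights. *)
Let socle k : set G := [set x | [/\ N x, K (x *+ p) & mulp N k x]].

Let socle_subgroup k : subgroup (socle k).
Proof.
split; first split.
- exact: (subgroup0 SN).
- by rewrite mul0rn; apply: (subgroup0 SK).
- exact: (subgroup0 (mulp_subgroup k SN)).
move=> x y [Nx Kx mx] [Ny Ky my]; split; first exact: subgroupB.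
  by rewrite mulrnBl; apply: subgroupB.
exact: (subgroupB (mulp_subgroup k SN)).
Qed.

Let torsion (x : G) : exists2 m, (0 < m)%N & x *+ m = 0.
Proof. by have [k xk] := Gp x; exists (p ^ k)%N; rewrite ?expn_gt0 ?prime_gt0. Qed.

(** Coordinate [k + 1], killed by [p ^ k.+1], detects the elements of the socle
    of height exactly [k]; coordinate [0] detects those of infinite height. *)
Lemma exists_ladder_map : exists g : G -> nat -> L -> D,
  [/\ zmod_morphism g, forall x, ladder S (g x), forall x, K x -> g x = 0,
      forall x k u, N x -> ladder S u -> g x = u *+ (p ^ k)%N ->
        exists a y, [/\ K a, N y & x = a + y *+ (p ^ k)%N] &
      forall x, N x -> g x = 0 -> K x].
Proof.
pose V k := if k is k'.+1 then socle k' else \bigcap_j socle j.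
pose W k := if k is k'.+1 then mulp setT k else K.
have NV k x : V k x -> N x /\ K (x *+ p).
  by case: k => [/(_ 0%N I)[]|k []].
have setTS : subgroup [set: G] by [].
have SV k : subgroup (V k).
  case: k => [|k]; last exact: socle_subgroup.
  split; first by move=> j _; apply: (subgroup0 (socle_subgroup j)).
  by move=> x y Vx Vy j _; apply: (subgroupB (socle_subgroup j)); [apply: Vx|apply: Vy].
have SW k : subgroup (W k) by case: k => // k; apply: mulp_subgroup.
have KW k x : K x -> W k x.
  by case: k => // k Kx; exists x, 0; rewrite mul0rn addr0.
have /choice[f fP] : forall k, exists f : G -> L -> D,
  [/\ zmod_morphism f, forall x, finsupp S (f x), forall x, W k x -> f x = 0 &
      forall x, V k x -> f x = 0 -> W k x].
  move=> k; apply: (@exists_separating_map L D zeta p _ _ _ _ G (V k) (W k) e) => //.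
  - by move=> x /NV[_ Kx]; apply: KW.
  - by move=> x y /NV[Nx _] /NV[Ny _]; apply: eI.
  - by move=> x /NV[Nx _]; apply: eS.
pose g x k := f k x.
have gB x y : g (x - y) = g x - g y.
  by apply: funext => k; have [fB _ _ _] := fP k; rewrite /g fB.
pose ga : {additive G -> nat -> L -> D} :=
  HB.pack g (GRing.isZmodMorphism.Build _ _ g gB).
have gMn x n : g (x *+ n) = g x *+ n by exact: (raddfMn ga).
have g0 : g 0 = 0 by exact: (raddf0 ga).
have gK x : K x -> g x = 0.
  by move=> Kx; apply: funext => k; have [_ _ f0 _] := fP k; apply/f0/KW.
have gL x : ladder S (g x).
  split=> [k|k|]; first by have [_ fS _ _] := fP k; apply: fS.
    have [_ _ f0 _] := fP k.+1.
    rewrite -fctMnE -gMn; apply: f0; exists 0, x; rewrite add0r; split=> //.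
    exact: (subgroup0 SK).
  by have [k xk] := Gp x; exists k; rewrite -gMn xk.
have ladderE u k j x : ladder S u -> g x = u *+ (p ^ k)%N -> (j < k)%N -> f j.+1 x = 0.
  move=> [_ uk _] gx jk; rewrite -[LHS]/(g x j.+1) gx fctMnE.
  exact: mulrn_pexp_le (uk j).
have socle_height x u k : N x -> K (x *+ p) -> ladder S u ->
    g x = u *+ (p ^ k)%N -> socle k x.
  move=> Nx Kpx Lu gx; suff h j : (j <= k)%N -> socle j x by apply: h.
  elim: j => [_|j IHj jk].
    split=> //; exists 0, x; rewrite add0r mulr1n; split=> //.
    exact: (subgroup0 SK).
  have [_ _ _ f0] := fP j.+1.
  have [a [y [Ka _ xE]]] := f0 x (IHj (ltnW jk)) (ladderE _ _ _ _ Lu gx jk).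
  have [|z Nz zy] := Npure (x := y) (k := j.+1).
    rewrite (_ : _ *+ _ = x - a); first by apply: (subgroupB SN) => //; apply: KN.
    by rewrite xE addrC addKr.
  by split=> //; exists a, z; rewrite zy.
have tors x : exists r, K (x *+ (p ^ r)%N).
  by have [r xr] := Gp x; exists r; rewrite xr; apply: (subgroup0 SK).
exists g; split=> //.
- move=> x k u Nx; have [r] := tors x; elim: r x u Nx => [|r IHr] x u Nx.
    rewrite mulr1n => Kx _ _; exists x, 0; rewrite mul0rn addr0; split=> //.
    exact: (subgroup0 SN).
  rewrite expnSr mulrnA => Kx Lu gx.
  have [_ _ [a [y [Ka Ny xE]]]] : socle (k + r) (x *+ (p ^ r)%N).
    apply: (socle_height _ u) => //; first exact: subgroupMn.
    by rewrite gMn gx expnD mulrnA.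
  have [||||b [z [Kb Nz xz]]] := IHr (x - y *+ (p ^ k)%N) (u - g y).
  + by apply: (subgroupB SN) => //; apply: subgroupMn.
  + by rewrite mulrnBl xE expnD mulrnA addrK.
  + by apply: (subgroupB (ladder_subgroup S)).
  + by rewrite gB gMn gx mulrnBl.
  exists b, (z + y); split=> //; first exact: subgroupD.
  by rewrite mulrnDl addrA -xz subrK.
- move=> x; have [r] := tors x; elim: r x => [|r IHr] x; first by rewrite mulr1n.
  rewrite expnSr mulrnA => Kx Nx gx; apply: IHr => //.
  have [_ _ _ f0] := fP 0%N; apply: f0; last first.
    by rewrite -[LHS]/(g _ 0%N) gMn gx mul0rn.
  move=> k _; apply: (socle_height _ 0) => //; first exact: subgroupMn.
    exact: (subgroup0 (ladder_subgroup S)).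
  by rewrite gMn gx !mul0rn.
Qed.

End LadderMap.
End Ladder.

(** * Abelian [p]-groups and purity *)

Section PGroups.
Variable p : nat.
Hypothesis pP : prime p.

Lemma abelian_pgroupP (G : zmodType) :
  abelian_pgroup p G <-> forall x : G, exists k, x *+ (p ^ k)%N = 0.
Proof.
split=> [Gp x|Gp x x0].
  have [->|/Gp[k [_ xk _]]] := pselect (x = 0); last by exists k.
  by exists 0%N.
have [k xk] := Gp x.
have exm : exists m, (0 < m)%N && (x *+ m == 0).
  by exists (p ^ k)%N; rewrite expn_gt0 prime_gt0 // xk /=.
case: (ex_minnP exm) => m /andP[m0 /eqP xm] mmin.
have /(dvdn_pfactor _ _ pP)[n _ mE] : (m %| p ^ k)%N.
  have xr : x *+ (p ^ k %% m)%N = 0.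
    by move: xk; rewrite {1}(divn_eq (p ^ k) m) mulrnDr mulnC mulrnA xm mul0rn add0r.
  rewrite /dvdn -leqn0 leqNgt; apply/negP => r0.
  have /mmin : (0 < p ^ k %% m)%N && (x *+ (p ^ k %% m)%N == 0).
    by rewrite r0 xr eqxx.
  by rewrite leqNgt ltn_pmod.
exists n; rewrite -mE; split=> // j /andP[j0 jm] xj.
by have := mmin j; rewrite j0 xj eqxx leqNgt jm => /(_ isT).
Qed.

(** Multiplication by an integer prime to [p] is bijective on a [p]-group, so
    that only the powers of [p] matter for purity. *)
Lemma pgroup_mulrn_inv (G : zmodType) (y : G) s r : y *+ (p ^ s)%N = 0 ->
  coprime p r -> exists t, y *+ (t * r)%N = y.
Proof.
move=> ys pr; have r0 : (0 < r)%N.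
  by case: r pr => //; rewrite /coprime gcdn0 => /eqP p1; move: pP; rewrite p1.
have /(coprimeP _ r0)[[t u] /= tu] : coprime r (p ^ s) by rewrite coprime_sym coprimeXl.
exists t; rewrite (_ : (t * r = u * p ^ s + 1)%N); last by lia.
by rewrite mulrnDr mulnC mulrnA ys mul0rn add0r.
Qed.

Lemma pure_embeddingI (G H : zmodType) (f : {additive G -> H}) :
  (forall x : G, exists k, x *+ (p ^ k)%N = 0) -> injective f ->
  (forall x k u, f x = u *+ (p ^ k)%N -> exists y, x = y *+ (p ^ k)%N) ->
  pure_embedding f.
Proof.
move=> Gp fI fpure; split=> //; split=> [|n].
  apply: (subgroup_zmod_closed (range f)).1; split; first by exists 0; rewrite ?raddf0.
  by move=> _ _ [x _ <-] [y _ <-]; exists (x - y); rewrite ?raddfB.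
apply/seteqP; split=> [_ [[u _ <-] [x _ fx]]|_ [_ [x _ <-] <-]]; last first.
  by split; [exists (f x)|exists (x *+ n); rewrite ?raddfMn].
have [->|n0] := posnP n.
  by exists 0; [exists 0; rewrite ?raddf0|rewrite !mulr0n].
have nE : n = (n`_(p^') * p ^ logn p n)%N by rewrite -p_part mulnC partnC.
have [y xy] : exists y, x = y *+ (p ^ logn p n)%N.
  by apply: (fpure _ _ (u *+ n`_(p^')%N)); rewrite fx {1}nE mulrnA.
have [s ys] := Gp y.
have [|t yt] := pgroup_mulrn_inv (r := n`_(p^')%N) ys.
  by rewrite prime_coprime // -p'natE // part_pnat.
exists (f (y *+ t)); first by exists (y *+ t).
by rewrite -raddfMn -fx xy -{2}yt {1}nE -!mulrnA mulnA.
Qed.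

Lemma pure_embeddingE (G H : zmodType) (f : {additive G -> H}) x n u :
  pure_embedding f -> f x = u *+ n -> exists y, x = y *+ n.
Proof.
move=> [fI [_ /(_ n) fp]] fx.
have : [set f y *+ n | y in [set: G]] (f x).
  have : ([set y *+ n | y in [set: H]] `&` range f) (f x).
    by split; [exists u|exists x].
  by rewrite fp => -[_ [y _ <-] yx]; exists y.
by move=> [y _ /esym]; rewrite -raddfMn => /fI ->; exists y.
Qed.

(** ** Pure hulls *)

Section PureHull.
Variable G : zmodType.
Implicit Type X : set G.

Definition pick_root k (x : G) : G := xget 0 [set y | y *+ (p ^ k)%N = x].

Inductive pure_hull X : G -> Prop :=
| PureHull_in x of X x : pure_hull X x
| PureHull_0 : pure_hull X 0
| PureHull_B x y of pure_hull X x & pure_hull X y : pure_hull X (x - y)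
| PureHull_root k x of pure_hull X x : pure_hull X (pick_root k x).

Lemma pure_hull_subgroup X : subgroup (pure_hull X).
Proof. by split; [exact: PureHull_0|exact: PureHull_B]. Qed.

Lemma pure_hull_pure X x k : pure_hull X (x *+ (p ^ k)%N) ->
  exists2 y, pure_hull X y & y *+ (p ^ k)%N = x *+ (p ^ k)%N.
Proof.
move=> Xx; exists (pick_root k (x *+ (p ^ k)%N)); first exact: PureHull_root.
by apply: (@xgetI _ 0 [set y | y *+ (p ^ k)%N = x *+ (p ^ k)%N] x).
Qed.

Lemma pure_hull_mono X Y : X `<=` Y -> pure_hull X `<=` pure_hull Y.
Proof.
move=> XY x; elim=> [{}x /XY|||]; [exact: PureHull_in|exact: PureHull_0| |].
  by move=> y z _ Yy _ Yz; apply: PureHull_B.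
by move=> k y _; apply: PureHull_root.
Qed.

(** The elements of a pure hull are the values of finite expressions; counting
    these bounds its size. *)
Inductive hull_term (T : Type) :=
| TermVar of T | Term0 | TermB of hull_term T & hull_term T
| TermRoot of nat & hull_term T.

Lemma embeds_hull_term T B : embeds nat B -> embeds T B -> embeds (hull_term T) B.
Proof.
move=> [iota iotaI] [f fI]; have [h hI] := embeds_square iotaI.
pose fix code (t : hull_term T) : B := match t with
  | TermVar x => h (iota 0%N, f x)
  | Term0 => h (iota 1%N, iota 0%N)
  | TermB a b => h (iota 2%N, h (code a, code b))
  | TermRoot k a => h (iota 3%N, h (iota k, code a))
  end.
exists code; elim=> [x||a IHa b IHb|k a IHa] [y||c d|l c] //= /hI[].
all: try by move=> /iotaI.
- by move=> /fI ->.
- by move=> /hI[/IHa -> /IHb ->].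
- by move=> /hI[/iotaI -> /IHa ->].
Qed.

Lemma embeds_pure_hull X B : embeds nat B -> embeds {x | X x} B ->
  embeds {x | pure_hull X x} B.
Proof.
move=> natB XB.
pose fix eval (t : hull_term {x | X x}) : {x | pure_hull X x} := match t with
  | TermVar x => exist _ _ (PureHull_in (svalP x))
  | Term0 => exist _ _ (PureHull_0 X)
  | TermB a b => exist _ _ (PureHull_B (svalP (eval a)) (svalP (eval b)))
  | TermRoot k a => exist _ _ (PureHull_root k (svalP (eval a)))
  end.
apply: embeds_trans (embeds_hull_term natB XB).
apply: (@embeds_quotient _ _ eval) => -[x Xx].
suff [t tx] : exists t, sval (eval t) = x by exists t; apply: eq_sig_hprop.
elim: Xx => [{}x Xx||{}x y _ [t <-] _ [u <-]|k {}x _ [t <-]].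
- by exists (TermVar (exist _ x Xx)).
- by exists (Term0 _).
- by exists (TermB t u).
- by exists (TermRoot k t).
Qed.

End PureHull.
End PGroups.

(** * Existence of universal groups *)

Lemma embeds_finsupp (L : Type) (D : zmodType) (S : set L) B : embeds nat B ->
  embeds D nat -> embeds {l | S l} B -> embeds {c : L -> D | finsupp S c} B.
Proof.
move=> natB Dnat SB.
pose sum (s : seq ({l | S l} * D)) : L -> D :=
  foldr (fun u c => single (sval u.1) u.2 + c) 0 s.
have sumS s : finsupp S (sum s).
  elim: s => [|u s IHs] /=; first exact: (subgroup0 (finsupp_subgroup D S)).
  apply: (subgroupD (finsupp_subgroup D S)) => //; apply: finsupp_single.
  exact: svalP.
apply: (@embeds_trans (seq ({l | S l} * D))); last first.
  apply: (@embeds_trans (seq B)); last exact: embeds_seq.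
  have [iota iotaI] := natB.
  have [f fI] := embeds_trans (embeds_prod SB (embeds_trans Dnat natB))
    (embeds_square iotaI).
  by exists (map f); apply: inj_map.
apply: (@embeds_quotient _ _ (fun s => exist (finsupp S) (sum s) (sumS s))).
move=> [c cS]; suff [s sc] : exists s, sum s = c.
  by exists s; apply: eq_sig_hprop.
have [cf cS'] := cS.
have /finite_seqP[t tE] : finite_set ([set l | c l <> 0] : set {classic L}) by [].
have : forall l : {classic L}, c l <> 0 -> l \in t.
  by move=> l cl; have : [set` t] l by rewrite -tE.
move=> {tE cf cS}; elim: t c cS' => [|l t IHt] c cS ct.
  exists [::]; apply: funext => l; apply: contrapT => /nesym cl.
  by have := ct l cl.
have [cl0|cl] := pselect (c l = 0).
  apply: IHt => // l' cl'; have := ct l' cl'.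
  by rewrite inE => /orP[/eqP ll'|//]; case: cl'; rewrite ll'.
have [l'|l' cl'|s sE] := IHt (c - single l (c l)).
- rewrite fctBE => cl'; apply: cS => cl'0; apply: cl'; rewrite cl'0 sub0r.
  rewrite /single; case: asboolP => [l'l|_]; last exact: oppr0.
  by case: cl; rewrite -l'l.
- have [l'l|nl'l] := pselect (l' = l).
    by case: cl'; rewrite l'l fctBE single_id subrr.
  have : c l' <> 0.
    move=> cl'0; apply: cl'; rewrite fctBE cl'0 sub0r /single.
    by case: asboolP => // _; exact: oppr0.
  by move=> /ct; rewrite inE => /orP[/eqP //|].
- by exists ((exist _ l (cS _ cl), c l) :: s); rewrite /= sE addrC subrK.
Qed.

Section Universal.
Variables (p : nat) (L : cardinal) (D : zmodType) (zeta : D).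
Hypothesis pP : prime p.
Hypothesis div : forall (x : D) m, (0 < m)%N -> exists y, y *+ m = x.
Hypothesis zeta0 : zeta <> 0.
Hypothesis zetap : zeta *+ p = 0.
Hypothesis Dnat : embeds D nat.
Hypothesis natL : embeds nat L.

Variable A : nat -> set L.
Hypothesis A_mono : forall n x, A n x -> A n.+1 x.
Hypothesis A_cover : forall x, exists n, A n x.
Hypothesis natA : forall n, embeds nat {x | A n x}.
Hypothesis A_power : forall n, embeds (nat -> {x | A n x}) L.

Let ladderp := @ladder L D p.

(** The direct sum of the ladder groups over the [A n]. *)
Let ladder_sum : set (nat -> nat -> L -> D) :=
  [set u | (forall n, ladderp (A n) (u n)) /\
           exists M, forall n, (M <= n)%N -> u n = 0].

Let ladder_sum_subgroup : subgroup ladder_sum.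
Proof.
split.
  split=> [n|]; [exact: (subgroup0 (ladder_subgroup D p (A n)))|by exists 0%N].
move=> u v [uL [M uM]] [vL [N vN]]; split=> [n|].
  by apply: (subgroupB (ladder_subgroup D p (A n))); [apply: uL|apply: vL].
exists (maxn M N) => n; rewrite geq_max => /andP[Mn Nn].
by rewrite fctBE uM ?vN ?subrr.
Qed.

Let ladder_sum_torsion u : ladder_sum u -> exists k, u *+ (p ^ k)%N = 0.
Proof.
move=> [uL [M uM]].
suff [k uk] : exists k, forall n, (n < M)%N -> u n *+ (p ^ k)%N = 0.
  exists k; apply: funext => n; rewrite fctMnE.
  by have [/uk//|/uM->] := ltnP n M; rewrite mul0rn.
elim: M {uM} => [|M [k IHM]]; first by exists 0%N.
have [_ _ [j uj]] := uL M.
exists (maxn k j) => n; rewrite ltnS leq_eqVlt => /orP[/eqP->|nM].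
  exact: mulrn_pexp_le (leq_maxr _ _) uj.
exact: mulrn_pexp_le (leq_maxl _ _) (IHM _ nM).
Qed.

Let embeds_ladder_sum : embeds {u | ladder_sum u} L.
Proof.
have ladderL n : embeds {g | ladderp (A n) g} L.
  apply: embeds_trans (A_power n).
  have [f fI] := embeds_finsupp (natA n) Dnat (embeds_refl _).
  have gk (g : {g | ladderp (A n) g}) k : finsupp (A n) (sval g k).
    by have [] := svalP g.
  exists (fun g k => f (exist _ _ (gk g k))) => g h gh.
  apply: eq_sig_hprop => //; apply: funext => k.
  by have /fI/(congr1 sval) := congr1 (fun w => w k) gh.
pose j n := projT1 (cid (ladderL n)).
have jI n : injective (j n) := projT2 (cid (ladderL n)).
have bound (u : {u | ladder_sum u}) : exists M, forall n, (M <= n)%N -> sval u n = 0.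
  by have [] := svalP u.
have [M MP] := choice bound.
have un (u : {u | ladder_sum u}) n : ladderp (A n) (sval u n).
  by have [uL _] := svalP u.
apply: embeds_trans (embeds_seq natL).
pose code u := mkseq (fun n => j n (exist _ _ (un u n))) (M u).
exists code => u v uv; have Muv : M u = M v.
  by have := congr1 size uv; rewrite !size_mkseq.
apply: eq_sig_hprop => //; apply: funext => n.
have [nM|nM] := ltnP n (M u); last by rewrite !MP // -Muv.
have := congr1 (fun s => nth (j n (exist _ _ (un u n))) s n) uv.
by rewrite !nth_mkseq -?Muv // => /jI/(congr1 sval).
Qed.

Let embeds_into_ladder_sum : embeds L {u | ladder_sum u}.
Proof.
have [n nP] := choice A_cover.
pose u l : nat -> nat -> L -> D := single (n l) (single 0%N (single l zeta)).
have uL l : ladder_sum (u l).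
  split=> [m|]; last first.
    by exists (n l).+1 => m nm; apply: contrapT => um;
      move: nm; rewrite (single_neq um) ltnn.
  rewrite /u /single; case: asboolP => [->|_]; last first.
    exact: (subgroup0 (ladder_subgroup D p (A m))).
  split=> [k|k|].
  - case: asboolP => _; last exact: (subgroup0 (finsupp_subgroup D _)).
    exact: finsupp_single (nP l).
  - by case: asboolP => // _; exact: mul0rn.
  - exists 1%N; apply: funext => k; apply: funext => l'; rewrite !fctMnE.
    by case: asboolP => _ //; [case: ifP => _|]; rewrite ?mul0rn.
exists (fun l => exist _ _ (uL l)) => l l' /(congr1 sval) /= uu.
have := congr1 (fun w => w (n l) 0%N l) uu; rewrite /= {1}/u !single_id.
move=> zE; apply: (@single_neq _ _ _ _ zeta).
have := zE; rewrite /u /(single (n l')); case: asboolP => [_|_ z0]; last by case: zeta0.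
by rewrite single_id => <-.
Qed.

(** A [p]-group [G] embedded as a set in [L] is the union of the pure hulls [G n]
    of the preimages of the [A n].  The [n]-th component of the embedding kills
    the preceding hull ([0] when [n = 0]) and embeds the quotient of [G n] by it
    purely, so that on each element of [G] almost all components vanish. *)
Lemma exists_universal_pgroup : exists U : zmodType, universal_pgroup p L U.
Proof.
have [U [i [iI iU]]] := exists_subgroup_type ladder_sum_subgroup.
have iL x : ladder_sum (i x) by rewrite -iU; exists x.
have Up (x : U) : exists k, x *+ (p ^ k)%N = 0.
  have [k xk] := ladder_sum_torsion (iL x).
  by exists k; apply: iI; rewrite raddfMn raddf0.
exists U; split; first exact/abelian_pgroupP.
  apply/cardinal_eqE; split.
    apply: embeds_trans embeds_ladder_sum.
    by exists (fun x => exist _ _ (iL x)) => x y /(congr1 sval) /iI.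
  apply: embeds_trans embeds_into_ladder_sum _.
  apply: (@embeds_quotient _ _ (fun x => exist _ _ (iL x))) => -[u uL].
  have : range i u by rewrite iU.
  by move=> [x _ xu]; exists x; apply: eq_sig_hprop.
move=> G /(abelian_pgroupP pP) Gp /cardinal_leE[e eI].
pose Gn n := pure_hull p [set x | A n (e x)].
pose K n := if n is n'.+1 then Gn n' else [set 0].
have GnS n : subgroup (Gn n) by apply: pure_hull_subgroup.
have SK n : subgroup (K n).
  by case: n => // ; split=> // x y -> ->; rewrite subrr.
have KGn n : K n `<=` Gn n.
  case: n => [x ->|n]; first exact: PureHull_0.
  by apply: pure_hull_mono => x; apply: A_mono.
have Kmono m n : (m <= n)%N -> K m `<=` K n.
  move=> /subnKC <-; elim: (n - m)%N => [|k IHk] x; first by rewrite addn0.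
  by rewrite addnS => /IHk /KGn.
have /choice[g gP] : forall n, exists g : G -> nat -> L -> D,
    [/\ zmod_morphism g, forall x, ladderp (A n) (g x), forall x, K n x -> g x = 0,
      forall x k u, Gn n x -> ladderp (A n) u -> g x = u *+ (p ^ k)%N ->
        exists a y, [/\ K n a, Gn n y & x = a + y *+ (p ^ k)%N] &
      forall x, Gn n x -> g x = 0 -> K n x].
  move=> n; have [f fI] : embeds {x | Gn n x} {l | A n l}.
    apply: embeds_pure_hull => //.
    exists (fun x : {x | A n (e x)} => exist (A n) (e (sval x)) (svalP x)).
    by move=> x y /(congr1 sval)/= /eI; apply: eq_sig_hprop.
  pose en x := if pselect (Gn n x) is left Gx then sval (f (exist _ x Gx)) else e x.
  apply: (@exists_ladder_map L D zeta p pP div zeta0 zetap G (K n) (Gn n) en) => //.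
  - by move=> x k; apply: pure_hull_pure.
  - move=> x y Gx Gy; rewrite /en; case: pselect => // Gx'; case: pselect => // Gy'.
    by move=> /sval_inj/fI/(congr1 sval).
  - by move=> x Gx; rewrite /en; case: pselect => // Gx'; apply: svalP.
have Kcover x : exists n, K n x.
  by have [n An] := A_cover (e x); exists n.+1; apply: PureHull_in.
pose F x : nat -> nat -> L -> D := fun n => g n x.
have FL x : ladder_sum (F x).
  split=> [n|]; first by have [_ gL _ _ _] := gP n; apply: gL.
  have [M KM] := Kcover x; exists M => n Mn.
  by have [_ _ g0 _ _] := gP n; apply/g0/(Kmono _ _ Mn).
have FB x y : F (x - y) = F x - F y.
  by apply: funext => n; have [gB _ _ _ _] := gP n; apply: gB.
have /choice[h hF] : forall x, exists y, i y = F x.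
  by move=> x; have : range i (F x); [rewrite iU|move=> [y _ yx]; exists y].
have hB : zmod_morphism h by move=> x y; apply: iI; rewrite raddfB !hF FB.
pose ha : {additive G -> U} := HB.pack h (GRing.isZmodMorphism.Build _ _ h hB).
exists ha; apply: (pure_embeddingI pP Gp).
- apply: raddf_inj => x /= hx0.
  have F0 n : g n x = 0.
    by rewrite -[LHS]/(F x n) -hF hx0 raddf0.
  have [M] := Kcover x; elim: M => [//|M IHM GMx].
  by apply: IHM; have [_ _ _ _] := gP M; apply.
- move=> x k u /= hx; have Fx : F x = i u *+ (p ^ k)%N by rewrite -hF hx raddfMn.
  have [M] := Kcover x; elim: M x u {hx} Fx => [|M IHM] x u Fx.
    by move=> ->; exists 0; rewrite mul0rn.
  move=> GMx; have [_ _ _ gpure _] := gP M.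
  have [|a [y [Ka Gy xE]]] := gpure x k (i u M) GMx (proj1 (iL u) M).
    by rewrite -[LHS]/(F x M) Fx fctMnE.
  have [|z az] := IHM a (u - h y) _ Ka.
    rewrite raddfB mulrnBl -Fx hF xE -[a in LHS](addrK (y *+ (p ^ k)%N)) FB.
    by congr (_ - _); rewrite -!hF -!raddfMn; congr (i _); exact: (raddfMn ha).
  by exists (z + y); rewrite mulrnDl -az.
Qed.

End Universal.

(** * Non-existence of universal groups below the continuum *)

Lemma finite_embeds_nat T (P : set T) : finite_set P -> embeds {x | P x} nat.
Proof.
move=> Pf; have /finite_seqP[t tE] : finite_set (P : set {classic T}) by [].
have Pt (u : {x | P x}) : (sval u : {classic T}) \in t.
  by have : [set` t] (sval u) by rewrite -tE; apply: svalP.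
exists (fun u : {x | P x} => index (sval u : {classic T}) t) => u v uv.
apply: sval_inj; rewrite -[LHS](nth_index (sval u : {classic T}) (Pt u)) uv.
exact: (nth_index _ (Pt v)).
Qed.

Section CodingGroup.
Variables (p : nat) (D : zmodType) (zeta : D).
Hypothesis pP : prime p.
Hypothesis div : forall (x : D) m, (0 < m)%N -> exists y, y *+ m = x.
Hypothesis zetap : zeta *+ p = 0.

(** For each sequence [c d], the group contains the infinite sum [X d] of the
    elements [Y k (c d k)] of order [p] and height [k]; its truncations
    approximate it [p]-adically. *)
Lemma exists_coding_group (I J B : Type) (c : J -> nat -> I) :
  embeds nat B -> embeds I B -> embeds J B ->
  exists (G : zmodType) (co : {additive G -> nat -> I -> D})
      (Y : nat -> I -> G) (X : J -> G),
    [/\ forall g : G, exists k, g *+ (p ^ k)%N = 0, embeds G B,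
        forall g k, finite_set [set i | co g k i <> 0] /\
                    co g k.+1 *+ (p ^ k.+1)%N = 0,
        forall d k, co (X d) k.+1 = single (c d k) zeta &
        forall d k, exists Z,
          X d = \sum_(j < k.+1) Y j (c d j) + Z *+ (p ^ k.+1)%N].
Proof.
move=> natB IB JB.
have FS := finsupp_subgroup D [set: I].
have [T [i [iI iT]]] := exists_subgroup_type (ladder_subgroup D p [set: I]).
have iL x : ladder p setT (i x) by rewrite -iT; exists x.
have lift u : ladder p setT u -> exists x, i x = u.
  by rewrite -iT => -[x _ <-]; exists x.
have zp k : zeta *+ (p ^ k.+1)%N = 0 by rewrite expnS mulrnA zetap mul0rn.
have singleMn l (a : D) n : (single l a : I -> D) *+ n = single l (a *+ n).
  by apply: funext => l'; rewrite fctMnE /single; case: ifP => _ //; rewrite mul0rn.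
have single0 l : single l 0 = 0 :> (I -> D).
  by apply: funext => l'; rewrite /single; case: ifP.
have /choice[y yE] : forall kj : nat * I, exists x,
    i x = single kj.1.+1 (single kj.2 zeta).
  move=> [k j]; apply: lift; split=> [l|l|] /=.
  - rewrite /single; case: ifP => _; last exact: (subgroup0 FS).
    exact: finsupp_single.
  - rewrite {1}/single; case: ifP => _; last exact: mul0rn.
    by rewrite singleMn zp single0.
  - exists 1%N; apply: funext => l; rewrite fctMnE {1}/single.
    by case: ifP => _; rewrite ?mul0rn // singleMn zp single0.
have /choice[x xE] : forall d, exists x,
    i x = fun k => if k is k'.+1 then single (c d k') zeta else 0.
  move=> d; apply: lift; split=> [[|l]|l|] /=.
  - exact: (subgroup0 FS).
  - exact: finsupp_single.
  - by rewrite singleMn zp single0.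
  - exists 1%N; apply: funext => -[|l]; rewrite fctMnE ?mul0rn //.
    by rewrite singleMn zp single0.
have xz d k : exists z, x d - \sum_(j < k.+1) y (val j, c d j) = z *+ (p ^ k.+1)%N.
  have [|zk zkE] := div zeta (m := (p ^ k.+1)%N); first by rewrite expn_gt0 prime_gt0.
  have zkp j : (k < j)%N -> zk *+ (p ^ j.+1)%N = 0.
    move=> kj; apply: (@mulrn_pexp_le _ _ _ k.+2) => //.
    by rewrite expnSr mulrnA zkE.
  have [|z zE] := lift (fun k' => if k' is j.+1 then
      if (k < j)%N then single (c d j) zk else 0 else 0).
    split=> [[|j]|j|] /=.
    - exact: (subgroup0 FS).
    - by case: ifP => _; [apply: finsupp_single|apply: (subgroup0 FS)].
    - by case: ifP => [/zkp kj|_]; rewrite ?mul0rn // singleMn kj single0.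
    - exists k.+2; apply: funext => -[|j]; rewrite fctMnE ?mul0rn //.
      by case: ifP => _; rewrite ?mul0rn // singleMn zkp // single0.
  exists z; apply: iI; rewrite raddfB raddf_sum raddfMn zE xE.
  under eq_bigr do rewrite yE /=.
  apply: funext => -[|j]; rewrite fctBE fctMnE fct_sumE.
    by rewrite mul0rn big1 ?subr0 // => j _; rewrite /single; case: asboolP.
  have [jk|kj] := leqP j k.
    rewrite (bigD1 (Ordinal (jk : (j < k.+1)%N))) //= single_id.
    rewrite big1 ?addr0 ?subrr ?mul0rn //.
    move=> l; rewrite -val_eqE /= => /negbTE lj; rewrite /single.
    by case: asboolP => // -[jl]; rewrite jl eqxx in lj.
  rewrite singleMn zkE big1 ?subr0 // => l _; rewrite /single.
  by case: asboolP => // -[jl]; have := ltn_ord l; rewrite -jl ltnS leqNgt kj.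
pose X0 : set T := range y `|` range x.
have [G [j [jI jG]]] := exists_subgroup_type (pure_hull_subgroup p X0).
have liftG t : pure_hull p X0 t -> exists g, j g = t.
  by rewrite -jG => -[g _ <-]; exists g.
have /choice[Y YE] : forall kl, exists g, j g = y kl.
  by move=> kl; apply/liftG/PureHull_in; left; exists kl.
have /choice[X XE] : forall d, exists g, j g = x d.
  by move=> d; apply/liftG/PureHull_in; right; exists d.
pose co : {additive G -> nat -> I -> D} :=
  [the {additive G -> nat -> I -> D} of i \o j].
exists G, co, (fun k l => Y (k, l)), X; split.
- move=> g; have [_ _ [k ik]] := iL (j g); exists k.
  by apply: jI; apply: iI; rewrite !raddfMn ik !raddf0.
- apply: (@embeds_trans {t | pure_hull p X0 t}).
    have jX g : pure_hull p X0 (j g) by rewrite -jG; exists g.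
    by exists (fun g => exist _ _ (jX g)) => g g' /(congr1 sval) /jI.
  apply: embeds_pure_hull => //.
  apply: (@embeds_trans (nat * I + J)); last first.
    apply: embeds_sum => //; have [iota iotaI] := natB.
    exact: embeds_trans (embeds_prod natB IB) (embeds_square iotaI).
  have X0s (s : nat * I + J) : X0 (match s with inl kl => y kl | inr d => x d end).
    by case: s => [kl|d]; [left; exists kl|right; exists d].
  apply: (@embeds_quotient _ _ (fun s => exist X0 _ (X0s s))).
  move=> [t Xt]; have [[kl _ klt]|[d _ dt]] := Xt.
    by exists (inl kl); apply/sval_inj.
  by exists (inr d); apply/sval_inj.
- move=> g k; have [iF ik _] := iL (j g); split; last exact: ik.
  by have [] := iF k.
- by move=> d k; rewrite /= XE xE.
- move=> d k; have [z zE] := xz d k.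
  have [|t /liftG[Z <-] tz] := @pure_hull_pure p T X0 z k.+1.
    rewrite -zE -XE; under eq_bigr do rewrite -YE.
    by rewrite -raddf_sum -raddfB -jG; eexists.
  exists Z; apply: jI; rewrite raddfD raddfMn raddf_sum tz -zE XE.
  by under eq_bigr do rewrite YE; rewrite subrKC.
Qed.

End CodingGroup.

Lemma is_aleph1_below n (K : cardinal) : is_aleph n.+1 K ->
  exists2 W, is_aleph 1 W & embeds W K.
Proof.
elim: n K => [|n IHn] K alephK; first by exists K => //; apply: embeds_refl.
case: alephK => K' /IHn[W alephW WK'] [[/cardinal_leE K'K _] _].
by exists W => //; apply: embeds_trans WK' K'K.
Qed.

Lemma is_succ_cardinal_equiv (K L M : cardinal) : embeds L M -> embeds M L ->
  is_succ_cardinal K L -> is_succ_cardinal K M.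
Proof.
move=> LM ML [[/cardinal_leE KL nLK] Lm]; split; first split.
- by apply/cardinal_leE; apply: embeds_trans KL LM.
- move=> /cardinal_leE MK; apply: nLK; apply/cardinal_leE.
  exact: embeds_trans LM MK.
- move=> N /Lm/cardinal_leE LN; apply/cardinal_leE; exact: embeds_trans ML LN.
Qed.

(** The Kojman-Shelah argument.  A guessing sequence [C d] and an element [u] of
    [U] determine a set of integers: the [k] such that [u] is not congruent
    modulo [p ^ k.+1] to any element below [C d (2k+1)].  There are at most
    [U * U] such sets, so if [U] is below the continuum some set [b] is missed.
    In the coding group for the sequences [C d (2k + b k)], the element [X d] is
    built to have the set [b], and the image of [X d] under a pure embedding in
    [U] keeps it when [C d] runs through a suitable club. *)
Lemma universal_pgroup_continuum (p : nat) (K W : cardinal) (U : zmodType) :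
  prime p -> embeds nat K -> is_succ_cardinal K U -> is_aleph 1 W ->
  embeds W K -> universal_pgroup p U U -> embeds (nat -> bool) U.
Proof.
move=> pP natK KU [K0 /cardinal_eqE[K0nat natK0] K0W] WK [Up _ Uuniv].
have [D [zeta [div _ zeta0 zetap Dnat]]] := exists_prufer pP.
have natU : embeds nat U.
  by case: KU => -[/cardinal_leE KU' _] _; apply: embeds_trans KU'.
have [lt [wo segK bnd]] := successor_well_order natK KU.
have [ltW [woW _ bndW]] := successor_well_order natK0 K0W.
have [w0 _] := bndW False (fun v => match v with end) (embeds_False _).
have [C CP] := exists_guessing_sequences wo natK segK bnd woW
  (fun c => bndW nat c natK0) WK w0.
apply: contrapT => ncont.
pose near k c u := exists v w, lt v c /\ u = v + w *+ (p ^ k.+1)%N.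
pose code d u : nat -> bool := fun k => ~~ `[< near k (C d k.*2.+1) u >].
have [b bP] : exists b, forall d u, code d u <> b.
  apply: contrapT => /forallNP nb; apply: ncont.
  apply: (@embeds_trans (U * U)).
    apply: (@embeds_quotient _ _ (fun x => code x.1 x.2)) => b.
    by have /existsNP[d /existsNP[u /contrapT <-]] := nb b; exists (d, u).
  by have [iota iotaI] := natU; apply: embeds_square iotaI.
have [G [co [Y [X [Gp GU coF coX XY]]]]] := exists_coding_group pP div zetap
  (fun d k => C d (k.*2 + b k)%N) natU (embeds_refl U) (embeds_refl U).
have [||f fpure] := Uuniv G.
- exact/(abelian_pgroupP pP).
- exact/cardinal_leE.
(* [f (rep k v)] agrees with [v] modulo [p ^ k.+1], whenever [v] is congruent to
   some value of [f]. *)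
have /choice[rep repP] : forall kv : nat * U, exists g : G,
    forall g' w, f g' = kv.2 + w *+ (p ^ kv.1.+1)%N ->
    exists w', f g = kv.2 + w' *+ (p ^ kv.1.+1)%N.
  move=> [k v].
  have [[g' [w gw]]|ng] := pselect (exists g' w, f g' = v + w *+ (p ^ k.+1)%N).
    by exists g' => _ _ _; exists w.
  by exists 0 => g' w gw; case: ng; exists g', w.
have squareK : embeds (K * K) K.
  by have [iota iotaI] := natK; apply: embeds_square iotaI.
have [tr irr tri _] := wo.
have leK v : embeds {y | ~ lt v y} K.
  have [v' vv'] := bnd unit (fun=> v) (embeds_trans embeds_unit natK).
  apply: embeds_trans (segK v').
  have lev' (y : {y | ~ lt v y}) : lt (sval y) v'.
    case: y => y /= nvy; have [|<-|yv] := tri v y => //; first exact: (vv' tt).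
    exact: tr yv (vv' tt).
  exists (fun y => exist (fun z => lt z v') _ (lev' y)).
  by move=> y y' /(congr1 sval)/= /sval_inj.
(* The segment below a point closed under [h] is closed under addition, contains
   the [f (Y k v)] for its own [v], and bounds the supports of the representatives
   at level [k + 1]. *)
pose supp k v := {i | co (rep (k, v)) k.+1 i <> 0}.
have /choice[h hP] : forall v, exists c,
  [/\ forall y z, ~ lt v y -> ~ lt v z -> lt (y + z) c,
      forall k, lt (f (Y k v)) c &
      forall k i, co (rep (k, v)) k.+1 i <> 0 -> lt i c].
  move=> v.
  pose I : Type := {y | ~ lt v y} * {y | ~ lt v y} + (nat + {k : nat & supp k v}).
  have IK : embeds I K.
    apply: embeds_sum => //.
      by apply: embeds_trans (embeds_prod (leK v) (leK v)) squareK.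
    apply: embeds_sum => //.
    apply: (@embeds_Sigma _ _ nat _ natK natK natK) => k.
    by apply: finite_embeds_nat; have [] := coF (rep (k, v)) k.+1.
  pose g (s : I) : U := match s with
    | inl yz => sval yz.1 + sval yz.2
    | inr (inl k) => f (Y k v)
    | inr (inr ki) => sval (projT2 ki)
    end.
  have [c gc] := bnd I g IK; exists c; split=> [y z vy vz|k|k i ki].
  - exact: (gc (inl (exist _ y vy, exist _ z vz))).
  - exact: (gc (inr (inl k))).
  - exact: (gc (inr (inr (existT _ k (exist _ i ki))))).
have [d [Cinc Ch]] := CP h.
have Cmono m n : (m < n)%N -> lt (C d m) (C d n).
  move=> /subnKC <-; elim: (n - m.+1)%N => [|k IHk]; first by rewrite addn0.
  by rewrite addnS; apply: tr IHk _.
have closedD c y z : closed_under lt h c -> lt y c -> lt z c -> lt (y + z) c.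
  move=> hc yc zc; have [yz|<-|zy] := tri y z.
  - apply: (tr) (hc _ zc); have [yzh _ _] := hP z; apply: yzh => // zy.
    exact: irr (tr _ _ _ yz zy).
  - by apply: (tr) (hc _ yc); have [yzh _ _] := hP y; apply: yzh.
  - apply: (tr) (hc _ yc); have [yzh _ _] := hP y; apply: yzh => // yz.
    exact: irr (tr _ _ _ yz zy).
apply: (bP d (f (X d))); apply: funext => k; rewrite /code.
(* For [j < k] the index [2j + b j] is below [2k+1]; for [j = k] it is so just
   when [b k] is false. *)
have hc := Ch k.*2.+1; set c := C d k.*2.+1 in hc *.
case: (boolP (b k)) => bk; last first.
  apply/negbTE; rewrite negbK; apply/asboolP.
  have [Z XE] := XY d k; exists (\sum_(j < k.+1) f (Y j (C d (j.*2 + b j)%N))), (f Z).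
  split; last by rewrite XE raddfD raddf_sum raddfMn.
  have Yc j : (j <= k)%N -> lt (f (Y j (C d (j.*2 + b j)%N))) c.
    move=> jk; have [_ fY _] := hP (C d (j.*2 + b j)%N).
    apply: (tr) (fY j) _; apply: hc; apply: Cmono.
    have [jk'|->] : (j < k)%N \/ j = k by lia.
      by case: (b j); lia.
    by rewrite (negbTE bk); lia.
  elim: {-2}k (leqnn k) => [|m IHm] mk; first by rewrite big_ord1; apply: Yc.
  rewrite big_ord_recr /=; apply: closedD => //; last exact: Yc.
  by apply: IHm; apply: ltnW.
apply/negP => /asboolP[v [w [vc fX]]].
have [w' fr] := repP (k, v) _ _ fX; move: fr => /= fr.
have [|y Xy] := pure_embeddingE (x := X d - rep (k, v))
  (n := (p ^ k.+1)%N) (u := w - w') fpure.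
  by rewrite raddfB fX fr mulrnBl opprD addrACA subrr add0r.
have cor : co (rep (k, v)) k.+1 = single (C d (k.*2 + b k)%N) zeta.
  rewrite -coX; apply/esym/subr0_eq; rewrite -fctBE -raddfB Xy raddfMn fctMnE.
  by have [] := coF y k.
have [_ _ suppc] := hP v.
have /suppc ch : co (rep (k, v)) k.+1 (C d (k.*2 + b k)%N) <> 0.
  by rewrite cor single_id.
apply: (irr c); apply: (tr) (hc _ vc); move: ch.
by rewrite bk addn1.
Qed.

Theorem theorem0p1 (p : nat) (hp : prime p) :
  (forall L : cardinal, infinite_set [set: L] ->
     ([set: nat -> L] #= [set: L] \/
      (forall M : cardinal, cardinal_lt M L -> cardinal_lt (nat -> M) L)) ->
     exists U : zmodType, universal_pgroup p L U)
  /\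
  (forall n : nat, (2 <= n)%N ->
     forall L : cardinal, is_aleph n L ->
       ((exists U : zmodType, universal_pgroup p L U) <->
        cardinal_le (nat -> bool) L)).
Proof.
have exU (L : cardinal) : embeds nat L ->
    ([set: nat -> L] #= [set: L] \/
      (forall M : cardinal, cardinal_lt M L -> cardinal_lt (nat -> M) L)) ->
    exists U : zmodType, universal_pgroup p L U.
  move=> natL hL.
  have [A [A_mono A_cover natA A_power]] := countable_exhaustion natL hL.
  have [D [zeta [div _ zeta0 zetap Dnat]]] := exists_prufer hp.
  exact: (@exists_universal_pgroup p L D zeta hp div zeta0 zetap Dnat natL A).
split=> [L /infinite_embeds_nat|[|[|n]] // _ L alephL]; first exact: exU.
have natL := is_aleph_infinite alephL.
split=> [[U UP]|/cardinal_leE contL].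
  have [_ /cardinal_eqE[UL LU] _] := UP.
  have [K alephK KL] := alephL.
  have natK := @is_aleph_infinite n.+1 K alephK.
  have [W alephW WK] := is_aleph1_below alephK.
  have KU := is_succ_cardinal_equiv LU UL KL.
  apply/cardinal_leE; apply: (@embeds_trans U) => //.
  apply: (universal_pgroup_continuum hp natK KU alephW WK).
  case: UP => Up _ Uuniv; split=> //.
  move=> G Gp /cardinal_leE GU; apply: Uuniv => //; apply/cardinal_leE.
  exact: embeds_trans GU UL.
apply: exU => //; left; apply/cardinal_eqE; split.
  exact: is_aleph_countable_power alephL contL.
by exists (fun x _ => x) => x y /(congr1 (fun g => g 0%N)).
Qed.
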